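(* Let $(M,Q,\omega)$ be an almost quaternionic skew-Hermitian manifold of dimension $4n$, $n>1$, with fundamental symmetric 4-tensor $\Phi$, let $\nabla$ be any affine connection on $M$, and put $$\mathsf{s}(\nabla\Phi):=-\Big(\frac{\mathsf{w}_1}{8(2n-1)}+\frac{\mathsf{w}_2}{8(n-1)}-\frac{3\,\mathsf{w}_3}{16n}+\frac{3\,\mathsf{w}_4}{8(n+1)}\Big)\big(\mathsf{c}(\nabla\Phi)\big).$$ The map $\mathsf{s}$ satisfies $\mathsf{p}\circ\mathsf{s}=\mathrm{Id}_{\mathscr{E}}$. In particular, $$\nabla+\Big(\frac{\mathsf{w}_1}{8(2n-1)}+\frac{\mathsf{w}_2}{8(n-1)}-\frac{3\,\mathsf{w}_3}{16n}+\frac{3\,\mathsf{w}_4}{8(n+1)}\Big)\big(\mathsf{c}(\nabla\Phi)\big)$$ is an $\mathsf{SO}^*(2n)\mathsf{Sp}(1)$-connection (i.e. a connection preserving $Q$ and $\omega$).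
   Context: An almost quaternionic structure $Q\subset\mathrm{End}(TM)$ is a rank 3 subbundle locally spanned by triples (admissible bases) $\{J_1,J_2,J_3\}$ of almost complex structures with $J_1J_2=-J_2J_1=J_3$; $(Q,\omega)$ is almost quaternionic skew-Hermitian if $\omega$ is a non-degenerate 2-form with $\omega(J_aX,J_aY)=\omega(X,Y)$. Put $g_{J_a}(X,Y)=\omega(X,J_aY)$ (symmetric, signature $(2n,2n)$). For symmetric bilinear $B,g$, $(B\odot g)(y,z,u,v)=\frac16\big(B(y,z)g(u,v)+B(y,u)g(z,v)+B(y,v)g(z,u)+B(z,u)g(y,v)+B(z,v)g(y,u)+B(u,v)g(y,z)\big)$. The fundamental tensor $\Phi=\sum_{a}g_{J_a}\odot g_{J_a}\in\Gamma(S^4T^*M)$ is independent of the admissible basis; its stabilizer is $\mathsf{SO}^*(2n)\mathsf{Sp}(1)$. For an endomorphism $B$ of $T_xM$: $\pi_{1,1}(B)=\frac14(B-\sum_aJ_aBJ_a)$; $Sym(B)$ and $Asym(B)$ are the components of $B=Sym(B)+Asym(B)$ for which $\omega(Sym(B)\cdot,\cdot)$ is symmetric and $\omega(Asym(B)\cdot,\cdot)$ is skew-symmetric. For a $(1,2)$-tensor $A$ write $A_XY=A(X,Y)$ and define $\mathsf{w}_1(A)(X,Y)=\frac{\mathrm{Tr}(A_X)}{4n}Y$, $\mathsf{w}_2(A)(X,Y)=Asym(\pi_{1,1}(A_X))Y-\frac{\mathrm{Tr}(A_X)}{4n}Y$, $\mathsf{w}_3(A)(X,Y)=Sym(A_X-\pi_{1,1}(A_X))Y+\sum_a\frac{\mathrm{Tr}(A_X\circ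 J_a)}{4n}J_aY$, $\mathsf{w}_4(A)(X,Y)=Asym(A_X-\pi_{1,1}(A_X))Y$. These are equivariant projections onto subbundles $\mathcal{W}_1,\dots,\mathcal{W}_4$ of $T^*M\otimes\mathrm{End}(TM)$. For $A\in T^*M\otimes S^4T^*M$ let $\mathsf{c}(A)(x,y,z)=\sum_aA(x,J_ay,z,g_{J_a}^{-1})$, where inserting $g_{J_a}^{-1}$ in the last two slots means $\sum_i A(x,J_ay,z,w_i,w^i)$ for a basis $(w_i)$ and its $g_{J_a}$-dual basis $(w^i)$. The $(0,3)$-tensor $\mathsf{c}(A)$ is regarded as the $(1,2)$-tensor $C$ with $\omega(C(x,y),z)=\mathsf{c}(A)(x,y,z)$. $A\cdot\Phi$ is the natural (derivation) action, $(A\cdot\Phi)(x;y,z,u,v)=-\Phi(A_xy,z,u,v)-\Phi(y,A_xz,u,v)-\Phi(y,z,A_xu,v)-\Phi(y,z,u,A_xv)$. $\mathscr{E}\subset T^*M\otimes S^4T^*M$ is the subbundle of all $A\cdot\Phi$ with $A\in T^*M\otimes\mathrm{End}(TM)$; for every affine connection $\nabla$, $\nabla\Phi$ is a section of $\mathscr{E}$. $\mathsf{p}:T^*M\otimes\mathrm{End}(TM)\to\mathscr{E}$ is $\mathsf{p}(A)=A\cdot\Phi$, and $\mathsf{s}:\mathscr{E}\to\mathcal{W}_1\oplus\mathcal{W}_2\oplus\mathcal{W}_3\oplus\mathcal{W}_4$ is given on $\mathscr{E}$ by the same formula as in the claim. *)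

(* Defs.v *)
From HB Require Import structures.
From mathcomp Require Import all_boot all_order all_algebra.
From mathcomp Require Import all_classical all_reals all_analysis.

Set Implicit Arguments.
Unset Strict Implicit.
Unset Printing Implicit Defensive.

Import Order.TTheory GRing.Theory Num.Theory.
Import numFieldNormedType.Exports.

Local Open Scope classical_set_scope.
Local Open Scope ring_scope.

(** * Smooth manifolds *)

(* Meant for D open and V of finite dimension, where asking that p |-> 'd f p v
   is of class C^k for every v amounts to asking it of p |-> 'd f p. *)
Fixpoint Ck (R : realType) (V W : normedModType R) (k : nat) (D : set V)
    (f : V -> W) {struct k} : Prop :=
  match k with
  | 0%N => forall p, D p -> {for p, continuous f}
  | k'.+1 => (forall p, D p -> differentiable f p) /\
             (forall v, Ck k' D (fun p => 'd f p v))
  end.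

Definition Cinfty (R : realType) (V W : normedModType R) (D : set V)
    (f : V -> W) : Prop := forall k, Ck k D f.

(* The maps are total; only their restrictions to chart_dom and chart_cod
   matter. *)
Record chart (R : realType) (m : nat) (M : topologicalType) := Chart {
  chart_dom : set M;
  chart_cod : set 'cV[R]_m;
  chart_fun :> M -> 'cV[R]_m;
  chart_inv : 'cV[R]_m -> M;
  chart_dom_open : open chart_dom;
  chart_cod_open : open chart_cod;
  chart_funP : forall x, chart_dom x -> chart_cod (chart_fun x);
  chart_invP : forall p, chart_cod p -> chart_dom (chart_inv p);
  chart_funK : forall x, chart_dom x -> chart_inv (chart_fun x) = x;
  chart_invK : forall p, chart_cod p -> chart_fun (chart_inv p) = p;
  chart_fun_continuous : forall x, chart_dom x -> {for x, continuous chart_fun};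
  chart_inv_continuous : forall p, chart_cod p -> {for p, continuous chart_inv}
}.

Definition chart_image (R : realType) (m : nat) (M : topologicalType)
    (c : chart R m M) (U : set M) : set 'cV[R]_m :=
  chart_cod c `&` (chart_inv c @^-1` U).

(* chart_at x is a preferred chart around x; it is only used to represent
   tangent vectors at x (see below). *)
Record manifold (R : realType) (m : nat) (M : topologicalType) := Manifold {
  atlas : set (chart R m M);
  chart_at : M -> chart R m M;
  chart_at_atlas : forall x, atlas (chart_at x);
  chart_at_dom : forall x, chart_dom (chart_at x) x;
  atlas_compatible : forall c d, atlas c -> atlas d ->
    Cinfty (chart_image c (chart_dom d)) (d \o chart_inv c);
  manifold_hausdorff : hausdorff_space M;
  manifold_second_countable : @second_countable M
}.

Section Fields.
Variables (R : realType) (m : nat) (M : topologicalType) (S : manifold R m M).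

(* The tangent space at each x is 'cV_m: v : 'cV_m stands for the tangent
   vector whose components in the chart chart_at S x are v. Its endomorphisms
   are the matrices 'M_m, acting on columns. *)
Local Notation tangent := 'cV[R]_m.

(* From components in the chart c to components in the chart d, at p. *)
Definition change (c d : chart R m M) (p : M) (v : tangent) : tangent :=
  'd (d \o chart_inv c) (c p) v.

Definition smooth_fun (U : set M) (f : M -> R) : Prop :=
  forall c, atlas S c -> Cinfty (chart_image c U) (f \o chart_inv c).

Definition smooth_field (U : set M) (X : M -> tangent) : Prop :=
  forall c, atlas S c ->
    Cinfty (chart_image c U) (fun p =>
      change (chart_at S (chart_inv c p)) c (chart_inv c p)
        (X (chart_inv c p))).

Definition smooth_fun_near (x : M) (f : M -> R) : Prop :=
  exists U, [/\ open U, U x & smooth_fun U f].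

Definition smooth_field_near (x : M) (X : M -> tangent) : Prop :=
  exists U, [/\ open U, U x & smooth_field U X].

Definition smooth_endo (U : set M) (J : M -> 'M[R]_m) : Prop :=
  forall (V : set M) (X : M -> tangent), open V -> V `<=` U ->
    smooth_field V X -> smooth_field V (fun p => J p *m X p).

Definition smooth_form2 (omega : M -> tangent -> tangent -> R) : Prop :=
  forall (U : set M) (X Y : M -> tangent), open U ->
    smooth_field U X -> smooth_field U Y ->
    smooth_fun U (fun p => omega p (X p) (Y p)).

(* The derivative v(f) of f along the tangent vector v at x. *)
Definition dfun (f : M -> R) (x : M) (v : tangent) : R :=
  'd (f \o chart_inv (chart_at S x)) (chart_at S x x) v.

(* The coordinate vector field with constant components v in chart_at S x:
   smooth near x, with value v at x. *)
Definition extend (x : M) (v : tangent) : M -> tangent :=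
  fun p => change (chart_at S x) (chart_at S p) p v.

(* nabla x v Y is the covariant derivative, at x and in the direction of the
   tangent vector v at x, of a vector field Y that is smooth near x; its values
   on other Y are irrelevant. Locality is a consequence of the Leibniz rule,
   since the indicator function of an open neighbourhood of x is smooth
   near x. *)
Record affine_connection (nabla : M -> tangent -> (M -> tangent) -> tangent)
  : Prop := AffineConnection {
  connection_linear : forall x Y, smooth_field_near x Y ->
    linear (fun v => nabla x v Y);
  connection_add : forall x v Y Z,
    smooth_field_near x Y -> smooth_field_near x Z ->
    nabla x v (fun p => Y p + Z p) = nabla x v Y + nabla x v Z;
  connection_leibniz : forall x v f Y,
    smooth_fun_near x f -> smooth_field_near x Y ->
    nabla x v (fun p => f p *: Y p) = dfun f x v *: Y x + f x *: nabla x v Y;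
  connection_smooth : forall U X Y, open U ->
    smooth_field U X -> smooth_field U Y ->
    smooth_field U (fun p => nabla p (X p) Y)
}.

(* (nabla T)(v; y, z, u, w) at x. It is tensorial in y, z, u, w, so it may be
   computed with any local extensions of these vectors; we use [extend]. *)
Definition cov_deriv4 (nabla : M -> tangent -> (M -> tangent) -> tangent)
    (T : M -> tangent -> tangent -> tangent -> tangent -> R)
    (x : M) (v y z u w : tangent) : R :=
  let e := extend x in
  dfun (fun p => T p (e y p) (e z p) (e u p) (e w p)) x v
  - T x (nabla x v (e y)) z u w - T x y (nabla x v (e z)) u w
  - T x y z (nabla x v (e u)) w - T x y z u (nabla x v (e w)).

Definition preserves_form2 (nabla : M -> tangent -> (M -> tangent) -> tangent)
    (omega : M -> tangent -> tangent -> R) : Prop :=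
  forall x v Y Z, smooth_field_near x Y -> smooth_field_near x Z ->
    dfun (fun p => omega p (Y p) (Z p)) x v
    = omega x (nabla x v Y) (Z x) + omega x (Y x) (nabla x v Z).

(* For every local section J of Q, the endomorphism q = nabla_v J lies in Q. *)
Definition preserves_endo_bundle
    (nabla : M -> tangent -> (M -> tangent) -> tangent)
    (Q : M -> set 'M[R]_m) : Prop :=
  forall (U : set M) (J : M -> 'M[R]_m), open U -> smooth_endo U J ->
    (forall p, U p -> Q p (J p)) ->
    forall x v, U x -> exists2 q, Q x q &
      forall Y, smooth_field_near x Y ->
        nabla x v (fun p => J p *m Y p) - J x *m nabla x v Y = q *m Y x.

End Fields.

(** * Linear algebra of a tangent space *)

Section TangentSpace.
Variables (R : realType) (m : nat).
Local Notation tangent := 'cV[R]_m.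
Local Notation endo := 'M[R]_m.
Local Notation form2 := (tangent -> tangent -> R).
Local Notation tensor4 := (tangent -> tangent -> tangent -> tangent -> R).

Definition std (i : 'I_m) : tangent := delta_mx i 0.

Definition bilinear_form (b : form2) : Prop :=
  (forall x, scalar (b x)) /\ (forall y, scalar (b ^~ y)).

Definition nondegenerate (b : form2) : Prop :=
  forall x, (forall y, b x y = 0) -> x = 0.

Definition gram (b : form2) : endo := \matrix_(i, j) b (std i) (std j).

(* For b bilinear and omega bilinear nondegenerate, the unique C with
   omega(C x, y) = b(x, y); see endo_ofP. *)
Definition endo_of (omega b : form2) : endo :=
  (gram b *m invmx (gram omega))^T.

(* The g-dual basis of the standard basis; see dual_basisP. *)
Definition dual_basis (g : form2) (i : 'I_m) : tangent :=
  \sum_(j < m) invmx (gram g) i j *: std j.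

Lemma bilinear_gram b x y : bilinear_form b ->
  b x y = (x^T *m gram b *m y) 0 0.
Proof.
move=> [br bl].
have bD0 x' : b x' 0 = 0 by have := br x' (-1) 0 0; rewrite scaler0 addr0 mulN1r addNr.
have bD0' y' : b 0 y' = 0 by have := bl y' (-1) 0 0; rewrite scaler0 addr0 mulN1r addNr.
have suml (I : finType) (a : I -> R) (e : I -> tangent) y' :
    b (\sum_i a i *: e i) y' = \sum_i a i * b (e i) y'.
  elim/big_rec2: _ => [|i u v _ <-]; [exact: bD0'|exact: bl].
have sumr (I : finType) (a : I -> R) (e : I -> tangent) x' :
    b x' (\sum_i a i *: e i) = \sum_i a i * b x' (e i).
  elim/big_rec2: _ => [|i u v _ <-]; [exact: bD0|exact: br].
have dec (z : tangent) : z = \sum_i z i 0 *: std i.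
  by rewrite {1}[z]matrix_sum_delta; apply: eq_bigr => i _; rewrite big_ord1.
rewrite {1}[y]dec sumr [RHS]mxE; apply: eq_bigr => j _.
rewrite {1}[x]dec suml mulrC mxE; congr (_ * _).
by apply: eq_bigr => i _; rewrite !mxE.
Qed.

Lemma gram_unit b : bilinear_form b -> nondegenerate b -> gram b \in unitmx.
Proof.
move=> bb nb; rewrite -row_free_unit -kermx_eq0; apply/eqP/row_matrixP => i.
rewrite row0; apply: trmx_inj; rewrite trmx0; apply: nb => y.
rewrite bilinear_gram// trmxK.
have /sub_kermxP -> : (row i (kermx (gram b)) <= kermx (gram b))%MS by exact: row_sub.
by rewrite mul0mx mxE.
Qed.

Lemma endo_ofP omega b x y :
  bilinear_form omega -> nondegenerate omega -> bilinear_form b ->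
  omega (endo_of omega b *m x) y = b x y.
Proof.
move=> bo no bb; rewrite bilinear_gram// (bilinear_gram _ _ bb) /endo_of.
by rewrite trmx_mul trmxK -(mulmxA x^T) mulmxKV// gram_unit.
Qed.

Lemma dual_basisP g i k : bilinear_form g -> nondegenerate g ->
  g (dual_basis g i) (std k) = (i == k)%:R.
Proof.
move=> bg ng.
have -> : dual_basis g i = (row i (invmx (gram g)))^T.
  rewrite /dual_basis [RHS]matrix_sum_delta; apply: eq_bigr => j _.
  by rewrite big_ord1 !mxE.
rewrite bilinear_gram// trmxK -row_mul mulVmx ?gram_unit// /std.
rewrite -colE !mxE; done.
Qed.

(** ** The tensor Phi *)

(* The triple (J_1, J_2, J_3) is indexed from 0. *)
Definition admissible_triple (J : 'I_3 -> endo) : Prop :=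
  [/\ forall a, J a *m J a = - 1%:M,
      J 0 *m J 1 = J 2 & J 1 *m J 0 = - J 2].

Definition span3 (J : 'I_3 -> endo) : set endo :=
  [set B | exists c : 'I_3 -> R, B = \sum_(a < 3) c a *: J a].

Definition admissible_basis (Q : set endo) (J : 'I_3 -> endo) : Prop :=
  admissible_triple J /\ Q = span3 J.

Definition gJ (omega : form2) (J : endo) : form2 :=
  fun x y => omega x (J *m y).

Definition symprod (B g : form2) : tensor4 := fun y z u v =>
  6^-1 * (B y z * g u v + B y u * g z v + B y v * g z u
          + B z u * g y v + B z v * g y u + B u v * g y z).

Definition Phi (omega : form2) (J : 'I_3 -> endo) : tensor4 := fun y z u v =>
  \sum_(a < 3) symprod (gJ omega (J a)) (gJ omega (J a)) y z u v.

(* Elements of T^* (x) S^4 T^* are functions of x, y, z, u, v, and elements A of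
   T^* (x) End(T) are functions x |-> A_x. *)
Definition action (A : tangent -> endo) (T : tensor4)
    : tangent -> tensor4 := fun x y z u v =>
  - T (A x *m y) z u v - T y (A x *m z) u v
  - T y z (A x *m u) v - T y z u (A x *m v).

Definition p_map (omega : form2) (J : 'I_3 -> endo) (A : tangent -> endo) :
  tangent -> tensor4 := action A (Phi omega J).

Definition E_fiber (omega : form2) (J : 'I_3 -> endo) : set (tangent -> tensor4) :=
  [set T | exists2 A, linear A & T = p_map omega J A].

(** ** The projections w_i and the contraction c *)

Definition pi11 (J : 'I_3 -> endo) (B : endo) : endo :=
  4^-1 *: (B - \sum_(a < 3) J a *m B *m J a).

Definition Sym (omega : form2) (B : endo) : endo :=
  endo_of omega (fun x y => 2^-1 * (omega (B *m x) y + omega (B *m y) x)).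

Definition Asym (omega : form2) (B : endo) : endo :=
  endo_of omega (fun x y => 2^-1 * (omega (B *m x) y - omega (B *m y) x)).

(* Here m = 4n is the dimension. *)
Definition w1 (A : tangent -> endo) : tangent -> endo := fun X =>
  (\tr (A X) / m%:R) *: 1%:M.

Definition w2 (omega : form2) (J : 'I_3 -> endo) (A : tangent -> endo) :
    tangent -> endo := fun X =>
  Asym omega (pi11 J (A X)) - (\tr (A X) / m%:R) *: 1%:M.

Definition w3 (omega : form2) (J : 'I_3 -> endo) (A : tangent -> endo) :
    tangent -> endo := fun X =>
  Sym omega (A X - pi11 J (A X))
  + \sum_(a < 3) (\tr (A X *m J a) / m%:R) *: J a.

Definition w4 (omega : form2) (J : 'I_3 -> endo) (A : tangent -> endo) :
    tangent -> endo := fun X =>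
  Asym omega (A X - pi11 J (A X)).

(* The image of a map of T^* (x) End(T). *)
Definition image_of (w : (tangent -> endo) -> tangent -> endo) :
  set (tangent -> endo) := [set B | exists2 A, linear A & B = w A].

Definition W1234 (omega : form2) (J : 'I_3 -> endo) : set (tangent -> endo) :=
  [set B | exists B1 B2 B3 B4,
    [/\ image_of w1 B1, image_of (w2 omega J) B2,
        image_of (w3 omega J) B3, image_of (w4 omega J) B4
      & B = fun X => B1 X + B2 X + B3 X + B4 X]].

Definition c_form (omega : form2) (J : 'I_3 -> endo) (T : tangent -> tensor4)
    (x y z : tangent) : R :=
  \sum_(a < 3) \sum_(i < m)
    T x (J a *m y) z (std i) (dual_basis (gJ omega (J a)) i).

(* c_form as a (1,2)-tensor: omega(c_map T x y, z) = c_form T x y z. *)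
Definition c_map (omega : form2) (J : 'I_3 -> endo) (T : tangent -> tensor4) :
    tangent -> endo := fun x =>
  endo_of omega (c_form omega J T x).

End TangentSpace.

Section Correction.
Variables (R : realType) (n : nat).
Local Notation tangent := 'cV[R]_(4 * n).
Local Notation endo := 'M[R]_(4 * n).

Definition correction (omega : tangent -> tangent -> R) (J : 'I_3 -> endo)
    (T : tangent -> tangent -> tangent -> tangent -> tangent -> R) :
    tangent -> endo := fun X =>
  let C := c_map omega J T in
  (1 / (8 * (2 * n%:R - 1))) *: w1 C X
  + (1 / (8 * (n%:R - 1))) *: w2 omega J C X
  - (3 / (16 * n%:R)) *: w3 omega J C X
  + (3 / (8 * (n%:R + 1))) *: w4 omega J C X.

Definition s_map (omega : tangent -> tangent -> R) (J : 'I_3 -> endo)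
    (T : tangent -> tangent -> tangent -> tangent -> tangent -> R) :
    tangent -> endo := fun X => - correction omega J T X.

End Correction.

(** * Almost quaternionic skew-Hermitian manifolds *)

Section AlmostQuaternionic.
Variables (R : realType) (m : nat) (M : topologicalType) (S : manifold R m M).

Definition almost_quaternionic (Q : M -> set 'M[R]_m) : Prop :=
  forall x, exists (U : set M) (J : 'I_3 -> M -> 'M[R]_m),
    [/\ open U, U x, forall a, smooth_endo S U (J a)
      & forall p, U p -> admissible_basis (Q p) (fun a => J a p)].

Record almost_quaternionic_skew_hermitian (Q : M -> set 'M[R]_m)
    (omega : M -> 'cV[R]_m -> 'cV[R]_m -> R) : Prop := AQSH {
  aqsh_quaternionic : almost_quaternionic Q;
  aqsh_smooth : smooth_form2 S omega;
  aqsh_bilinear : forall x, bilinear_form (omega x);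
  aqsh_skew : forall x X Y, omega x Y X = - omega x X Y;
  aqsh_nondegenerate : forall x, nondegenerate (omega x);
  aqsh_invariant : forall x J, admissible_basis (Q x) J ->
    forall a X Y, omega x (J a *m X) (J a *m Y) = omega x X Y
}.

End AlmostQuaternionic.

(* Main.v *)
Require Import Defs.
From HB Require Import structures.
From mathcomp Require Import all_boot all_order all_algebra ring.
From mathcomp Require Import all_classical all_reals all_analysis.

Set Implicit Arguments.
Unset Strict Implicit.
Unset Printing Implicit Defensive.

Import Order.TTheory GRing.Theory Num.Theory.
Import numFieldNormedType.Exports.

Local Open Scope classical_set_scope.
Local Open Scope ring_scope.

(* Fix a point and write A* for the omega-adjoint of an endomorphism A.
   Contracting A.Phi gives, with m = 4n,
     3 c(A.Phi) = - 3m A* + (m-4) sum_a J_a A J_a - 4 sum_a J_a A* J_a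
                  - 6 tr A + 4 sum_a tr(A J_a) J_a,
   so that c o p acts on each W_i as a scalar, the one inverted by s. Hence
   s(A.Phi) = A - A_0, where A_0, the component of A in so*(2n) + sp(1),
   annihilates Phi; this gives p o s = Id.
   For the connection, take a smooth local admissible basis. Averaging nabla over
   1, J_1, J_2, J_3 gives a local connection preserving the J_a, and correcting it
   by half of omega^-1 times its derivative of omega gives one, D, that also
   preserves omega. Then nabla = D + A with A a tensor, so nabla Phi = A.Phi, and
   the corrected connection is nabla - s(A.Phi) = D + A_0. It preserves Q and
   omega because D and A_0 do, and it is smooth because D and A_0 are. *)

(** * Linear algebra of a tangent space *)

(** The constants in s come from two commuting operators on endomorphisms: the adjoint, with
    eigenvalues 1 and -1, and B |-> sum_a J_a B J_a, with eigenvalue -3 on the commutant of the J_a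
    and 1 on its complement. Their joint eigenspaces, with the scalars and the span of the J_a split
    off, are the fibres behind W_1, ..., W_4 together with so*(2n) and sp(1). On these c o p is
    multiplication by -8(2n-1), -8(n-1), 16n/3, -8(n+1)/3 and 0, 0; the condition n > 1 keeps the
    second scalar away from zero. On the manifold the obstacle is that Phi is written with a basis
    chosen point by point, which need not be differentiable. Two admissible bases of the same space
    differ by an orthogonal matrix, so Phi and A_0 can be rewritten in a smooth local basis. The
    connection D built from that basis exists only on an open set; it is therefore handled one point
    and one direction at a time, as a map on fields smooth near the point that obeys the Leibniz
    rule. *)

Lemma sum3 (V : nmodType) (F : 'I_3 -> V) :
  \sum_(a < 3) F a = F 0 + F 1 + F 2.
Proof.
rewrite !big_ord_recl big_ord0 addr0 -addrA; congr (F _ + (F _ + F _));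
  exact: val_inj.
Qed.

Lemma forall3 (P : 'I_3 -> Prop) : P 0 -> P 1 -> P 2 -> forall a, P a.
Proof.
move=> P0 P1 P2 [[|[|[|//]]] h].
- by rewrite (_ : Ordinal h = 0)//; exact: val_inj.
- by rewrite (_ : Ordinal h = 1)//; exact: val_inj.
- by rewrite (_ : Ordinal h = 2)//; exact: val_inj.
Qed.

Section BilinearForms.
Variables (R : realType) (m : nat).
Local Notation tangent := 'cV[R]_m.
Local Notation endo := 'M[R]_m.
Implicit Types (A B : endo) (b : tangent -> tangent -> R) (x y z : tangent).

Lemma gram_form A : gram (fun x y => (x^T *m A *m y) 0 0) = A.
Proof.
apply/matrixP => i j; rewrite !mxE (bigD1 j)//= big1 ?addr0; last first.
  by move=> k kj; rewrite [std _ _ _ _]mxE (negbTE kj) mulr0.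
rewrite !mxE !eqxx mulr1 (bigD1 i)//= big1 ?addr0; last first.
  by move=> k ki; rewrite !mxE (negbTE ki) mul0r.
by rewrite !mxE !eqxx mul1r.
Qed.

Lemma form_mx_inj A B :
  (forall x y, (x^T *m A *m y) 0 0 = (x^T *m B *m y) 0 0) -> A = B.
Proof.
move=> AB; rewrite -(gram_form A) -(gram_form B).
by congr gram; apply/funext => x; apply/funext => y.
Qed.

Variable b : tangent -> tangent -> R.
Hypothesis bb : bilinear_form b.

Lemma bilinearDl x y z : b (x + y) z = b x z + b y z.
Proof. by have := bb.2 z 1 x y; rewrite scale1r mul1r. Qed.
Lemma bilinearDr x y z : b x (y + z) = b x y + b x z.
Proof. by have := bb.1 x 1 y z; rewrite scale1r mul1r. Qed.
Lemma bilinear0l z : b 0 z = 0.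
Proof. by apply: (@addrI _ (b 0 z)); rewrite -bilinearDl !addr0. Qed.
Lemma bilinear0r x : b x 0 = 0.
Proof. by apply: (@addrI _ (b x 0)); rewrite -bilinearDr !addr0. Qed.
Lemma bilinearZl k x z : b (k *: x) z = k * b x z.
Proof. by have := bb.2 z k x 0; rewrite !addr0 bilinear0l addr0. Qed.
Lemma bilinearZr k x y : b x (k *: y) = k * b x y.
Proof. by have := bb.1 x k y 0; rewrite !addr0 bilinear0r addr0. Qed.
Lemma bilinearNl x z : b (- x) z = - b x z.
Proof. by rewrite -scaleN1r bilinearZl mulN1r. Qed.
Lemma bilinearNr x y : b x (- y) = - b x y.
Proof. by rewrite -scaleN1r bilinearZr mulN1r. Qed.
Lemma bilinear_suml (I : finType) (F : I -> tangent) z :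
  b (\sum_i F i) z = \sum_i b (F i) z.
Proof. by elim/big_rec2: _ => [|i u v _ <-]; rewrite ?bilinear0l ?bilinearDl. Qed.

Definition bilinearE := (bilinearDl, bilinearDr, bilinearZl, bilinearZr, bilinearNl, bilinearNr).
End BilinearForms.

(** * Adjoints with respect to omega, and the contraction of A . Phi *)

Section TangentSpace.
Variables (R : realType) (m : nat).
Local Notation tangent := 'cV[R]_m.
Local Notation endo := 'M[R]_m.
Variable omega : tangent -> tangent -> R.
Hypotheses (omega_bilinear : bilinear_form omega)
  (omega_nondegenerate : Defs.nondegenerate omega)
  (omega_skew : forall X Y, omega Y X = - omega X Y).
Implicit Types (A B C : endo) (x y z : tangent).

Let G := gram omega.
Let omegaE x y : omega x y = (x^T *m G *m y) 0 0.
Proof. exact: bilinear_gram. Qed.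

Let Gu : G \in unitmx.
Proof. exact: gram_unit. Qed.

Let trG : G^T = - G.
Proof. by apply/matrixP => i j; rewrite !mxE. Qed.

Lemma omega_inj x y : (forall z, omega x z = omega y z) -> x = y.
Proof.
move=> h; apply/eqP; rewrite -subr_eq0; apply/eqP/omega_nondegenerate => z.
by rewrite !(bilinearE omega_bilinear) h subrr.
Qed.

Lemma endo_of_form C : endo_of omega (fun x y => omega (C *m x) y) = C.
Proof.
rewrite /endo_of -/G.
suff -> : gram (fun x y => omega (C *m x) y) = C^T *m G.
  by rewrite mulmxK// trmxK.
rewrite -[RHS]gram_form; congr gram; apply/funext => x; apply/funext => y.
by rewrite omegaE trmx_mul !mulmxA.
Qed.

(** Locked so that [mxE] does not expand it and the entrywise [ring] steps see an adjoint as an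
    atom. *)
Definition adjoint B : endo :=
  locked (invmx (gram omega) *m B^T *m gram omega).

Lemma adjointP B x y : omega (B *m x) y = omega x (adjoint B *m y).
Proof. by rewrite !omegaE /adjoint -!lock -/G trmx_mul !mulmxA mulmxK. Qed.

Lemma adjoint_unique A B : (forall x y, omega (A *m x) y = omega x (B *m y)) ->
  adjoint A = B.
Proof.
move=> AB; apply: (can_inj (mulKmx Gu)); apply: form_mx_inj => x y.
have GE C : (x^T *m (G *m C) *m y) 0 0 = omega x (C *m y) by rewrite omegaE !mulmxA.
by rewrite !GE -AB adjointP.
Qed.

Lemma adjointK B : adjoint (adjoint B) = B.
Proof.
by apply: adjoint_unique => x y; rewrite omega_skew -adjointP (omega_skew x) opprK.
Qed.

Lemma adjoint_formr B x y : omega x (B *m y) = omega (adjoint B *m x) y.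
Proof. by rewrite adjointP adjointK. Qed.

Lemma adjointM A B : adjoint (A *m B) = adjoint B *m adjoint A.
Proof. by apply: adjoint_unique => x y; rewrite -!mulmxA !adjointP. Qed.

Lemma adjointD A B : adjoint (A + B) = adjoint A + adjoint B.
Proof. by rewrite /adjoint -!lock linearD mulmxDr mulmxDl. Qed.
Lemma adjointZ k B : adjoint (k *: B) = k *: adjoint B.
Proof. by rewrite /adjoint -!lock linearZ/= -scalemxAr -scalemxAl. Qed.
Lemma adjointN B : adjoint (- B) = - adjoint B.
Proof. by rewrite -scaleN1r adjointZ scaleN1r. Qed.
Lemma adjoint_sum (I : finType) (F : I -> endo) :
  adjoint (\sum_i F i) = \sum_i adjoint (F i).
Proof.
apply: (big_morph _ adjointD).
by rewrite /adjoint -!lock trmx0 mulmx0 mul0mx.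
Qed.
Lemma adjoint1 : adjoint 1%:M = 1%:M.
Proof. by rewrite /adjoint -!lock trmx1 mulmx1 mulVmx. Qed.
Lemma tr_adjoint B : \tr (adjoint B) = \tr B.
Proof. by rewrite /adjoint -!lock mxtrace_mulC mulKVmx// mxtrace_tr. Qed.

(** Since omega is skew, omega(B x, y) is skew in x and y exactly when B is self-adjoint, and
    symmetric exactly when B is skew-adjoint; hence the signs here and in [SymE]. *)
Lemma AsymE B : Asym omega B = 2^-1 *: (B + adjoint B).
Proof.
rewrite /Asym -[RHS]endo_of_form; congr endo_of.
apply/funext => x; apply/funext => y.
rewrite -scalemxAl mulmxDl !(bilinearE omega_bilinear) -[omega (adjoint B *m x) y]adjoint_formr.
by rewrite (omega_skew x) opprK.
Qed.

Lemma SymE B : Sym omega B = 2^-1 *: (B - adjoint B).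
Proof.
rewrite /Sym -[RHS]endo_of_form; congr endo_of.
apply/funext => x; apply/funext => y.
rewrite -scalemxAl mulmxBl !(bilinearE omega_bilinear) -[omega (adjoint B *m x) y]adjoint_formr.
by rewrite (omega_skew x).
Qed.

Variable J : 'I_3 -> endo.
Hypothesis J_triple : admissible_triple J.
Hypothesis J_omega : forall a X Y, omega (J a *m X) (J a *m Y) = omega X Y.

Lemma JJ a : J a *m J a = - 1%:M. Proof. by case: J_triple. Qed.
Lemma J01 : J 0 *m J 1 = J 2. Proof. by case: J_triple. Qed.
Lemma J10 : J 1 *m J 0 = - J 2. Proof. by case: J_triple. Qed.
Lemma J12 : J 1 *m J 2 = J 0.
Proof. by rewrite -[J 2]opprK -J10 mulmxN mulmxA JJ mulNmx mul1mx opprK. Qed.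
Lemma J20 : J 2 *m J 0 = J 1.
Proof. by rewrite -[J 2]opprK -J10 mulNmx -mulmxA JJ mulmxN mulmx1 opprK. Qed.
Lemma J21 : J 2 *m J 1 = - J 0.
Proof. by rewrite -J01 -mulmxA JJ mulmxN mulmx1. Qed.
Lemma J02 : J 0 *m J 2 = - J 1.
Proof. by rewrite -J01 mulmxA JJ mulNmx mul1mx. Qed.
Definition JE := (JJ, J01, J10, J12, J20, J21, J02).

Lemma adjointJ a : adjoint (J a) = - J a.
Proof.
apply: adjoint_unique => x y.
by rewrite -(J_omega a) mulmxA JJ !mulNmx mul1mx !(bilinearE omega_bilinear).
Qed.

Lemma adjoint_sum_conjJ B : adjoint (\sum_(a < 3) J a *m B *m J a)
  = \sum_(a < 3) J a *m adjoint B *m J a.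
Proof.
rewrite adjoint_sum; apply: eq_bigr => a _.
by rewrite !adjointM !adjointJ !(mulmxN, mulNmx) opprK mulmxA.
Qed.

(** In the double sum the terms with a = b give 3 B; those with a != b equal - J_c B J_c, each c
    occurring twice. The operator T thus satisfies T^2 = 3 - 2 T, whence its eigenvalues 1 and
    -3. *)
Lemma conjJ_conjJ B :
  \sum_(a < 3) J a *m (\sum_(b < 3) J b *m B *m J b) *m J a
  = 3 *: B - 2 *: (\sum_(a < 3) J a *m B *m J a).
Proof.
rewrite !sum3 !(mulmxDl, mulmxDr) !mulmxA !JE -!mulmxA !JE.
rewrite !(mulmxN, mulNmx, mulmx1, mul1mx, opprK).
by apply/matrixP => i j; rewrite !mxE; ring.
Qed.

(** The term a = b is the cube of J_b, that is - J_b; each of the other two is J_b by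
    anticommutation. *)
Lemma conjJ_J b : \sum_(a < 3) J a *m J b *m J a = J b.
Proof.
move: b; apply: forall3; rewrite sum3 !JE !(mulNmx, mulmxN, JE, mul1mx, mulmx1);
  by apply/matrixP => i j; rewrite !mxE; ring.
Qed.

(** Off the diagonal the product is some J_c up to sign, and J_c is itself a product of two
    anticommuting factors, so cyclicity of the trace gives tr J_c = - tr J_c. *)
Lemma mxtraceJJ a b : \tr (J a *m J b) = - m%:R *+ (a == b).
Proof.
have trN (c : 'I_3) : \tr (J c) = 0.
  suff /eqP : \tr (J c) *+ 2 = 0 by rewrite mulrn_eq0 => /eqP.
  suff h : \tr (J c) = - \tr (J c) by rewrite mulr2n {1}h addNr.
  move: c; apply: forall3.
  - by rewrite -{1}J12 mxtrace_mulC J21 linearN.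
  - by rewrite -{1}J20 mxtrace_mulC J02 linearN.
  - by rewrite -{1}J01 mxtrace_mulC J10 linearN.
by move: a b; apply: forall3; apply: forall3;
  rewrite JE ?linearN/= ?trN ?mxtrace1 ?oppr0.
Qed.

Lemma mxtraceJ a : \tr (J a) = 0.
Proof.
move: a; apply: forall3.
- by rewrite -J12 mxtraceJJ.
- by rewrite -J20 mxtraceJJ.
- by rewrite -J01 mxtraceJJ.
Qed.

Let invG a : invmx (gram (gJ omega (J a))) = - (J a *m invmx G).
Proof.
have -> : gram (gJ omega (J a)) = G *m J a.
  rewrite -[RHS]gram_form; congr gram; apply/funext => x; apply/funext => y.
  by rewrite /gJ omegaE !mulmxA.
have h : - (J a *m invmx G) *m (G *m J a) = 1%:M.
  by rewrite mulNmx -mulmxA mulKmx// JJ opprK.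
by have [_ u] := mulmx1_unit h; apply: (can_inj (mulmxK u)); rewrite h mulVmx.
Qed.

Let dual_basisE a i :
  dual_basis (gJ omega (J a)) i = (- (J a *m invmx G))^T *m std R i.
Proof.
rewrite /dual_basis invG; set N := - _.
rewrite /std -colE [RHS]matrix_sum_delta; apply: eq_bigr => j _.
by rewrite big_ord1 !mxE.
Qed.

(** The sum of the w_i tensor w^i is the inverse matrix - J_a G^-1 of g_{J_a}. Transposing the
    second factor produces G^-1 B^T G, the adjoint of B, and the skewness of G absorbs the sign. *)
Lemma contraction_rank1 a A B x y :
  \sum_i omega x (A *m std R i) * omega y (B *m dual_basis (gJ omega (J a)) i)
  = omega x (A *m J a *m adjoint B *m y).
Proof.
transitivity ((x^T *m G *m A *m
    (y^T *m G *m B *m (- (J a *m invmx G))^T)^T) 0 0).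
  rewrite [RHS]mxE; apply: eq_bigr => i _.
  by rewrite dual_basisE !omegaE !mulmxA /std -!colE [in RHS]mxE !mxE.
rewrite !trmx_mul !trmxK trG omegaE /adjoint -!lock -/G !(mulNmx, mulmxN, opprK).
by rewrite !mulmxA.
Qed.

Lemma contraction_form a B :
  \sum_i omega (std R i) (B *m dual_basis (gJ omega (J a)) i)
  = - \tr (B *m J a).
Proof.
transitivity (\tr (G *m B *m (- (J a *m invmx G))^T)).
  apply: eq_bigr => i _; rewrite dual_basisE omegaE /std trmx_delta.
  by rewrite !mulmxA -colE [LHS]mxE -!mulmxA -rowE [LHS]mxE.
rewrite -mxtrace_tr !trmx_mul trmxK trG.
rewrite !(mulNmx, mulmxN) opprK -[in RHS]tr_adjoint adjointM adjointJ.
by rewrite mulNmx linearN opprK /adjoint -!lock -/G !mulmxA.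
Qed.

(** The endomorphism k with omega(y, k z) = (B . g_{J_b})(y, z), the derivation action of B on
    g_{J_b}. *)
Definition gJ_action B b := - (adjoint B *m J b + J b *m B).

(** This encodes that B . g_{J_b} is again a symmetric form. *)
Lemma adjoint_gJ_action B b : adjoint (gJ_action B b) = - gJ_action B b.
Proof.
rewrite /gJ_action adjointN adjointD !adjointM adjointK adjointJ !(mulNmx, mulmxN).
by rewrite addrC -opprD.
Qed.

Lemma omega_gJ_action B b x y : omega x (gJ_action B b *m y)
  = - omega (B *m x) (J b *m y) - omega x (J b *m (B *m y)).
Proof.
rewrite /gJ_action mulNmx mulmxDl -!mulmxA !(bilinearE omega_bilinear) -adjointP.
by rewrite opprD.
Qed.

(** By the Leibniz rule the action on the symmetric square of g_{J_b} is twice the symmetric product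
    of A_x . g_{J_b} with g_{J_b}; the 2 and the 1/6 of [symprod] make 1/3. *)
Lemma p_mapE (A : tangent -> endo) x y z u v : p_map omega J A x y z u v =
  3^-1 * \sum_(b < 3)
    (omega y (gJ_action (A x) b *m z) * omega u (J b *m v)
   + omega y (gJ_action (A x) b *m u) * omega z (J b *m v)
   + omega y (gJ_action (A x) b *m v) * omega z (J b *m u)
   + omega z (gJ_action (A x) b *m u) * omega y (J b *m v)
   + omega z (gJ_action (A x) b *m v) * omega y (J b *m u)
   + omega u (gJ_action (A x) b *m v) * omega y (J b *m z)).
Proof.
rewrite /p_map /action /Phi !sum3 /symprod /gJ !omega_gJ_action.
by field.
Qed.

(** Of the six products in [p_mapE], the first and the last contract to traces. The other four
    contract to compositions that agree in pairs, because k and the J_a are skew-adjoint; hence the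
    factors 2. *)
Lemma c_formE (A : tangent -> endo) x y z :
  c_form omega J (p_map omega J A) x y z =
  omega ((3^-1 *: \sum_(a < 3) \sum_(b < 3)
    (\tr (J b *m J a) *: (gJ_action (A x) b *m J a)
   + 2 *: (J b *m J a *m gJ_action (A x) b *m J a)
   + 2 *: (gJ_action (A x) b *m (J a *m J b *m J a))
   + \tr (gJ_action (A x) b *m J a) *: (J b *m J a))) *m y) z.
Proof.
rewrite -scalemxAl !(bilinearE omega_bilinear) mulmx_suml.
rewrite (bilinear_suml omega_bilinear) /c_form mulr_sumr; apply: eq_bigr => a _.
under eq_bigr do rewrite p_mapE mulr_sumr.
rewrite exchange_big mulmx_suml (bilinear_suml omega_bilinear) mulr_sumr.
apply: eq_bigr => b _; rewrite -mulr_sumr; congr (_ * _).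
rewrite !big_split/= -!mulr_sumr -mulr_suml.
(* In the products whose first factor contains the dual vector w^i, the factors are exchanged to fit
   [contraction_rank1]. *)
under [X in _ + _ + X + _ + _ + _ = _]eq_bigr do rewrite mulrC.
under [X in _ + X + _ = _]eq_bigr do rewrite mulrC.
rewrite !contraction_form !contraction_rank1.
have zl C : omega z (C *m (J a *m y)) = - omega (C *m J a *m y) z.
  by rewrite omega_skew mulmxA.
have yl C : omega (J a *m y) (C *m z) = omega (adjoint C *m J a *m y) z.
  by rewrite adjoint_formr mulmxA.
have := adjoint_gJ_action (A x) b; move: (gJ_action _ b) => k kE.
rewrite !zl !yl !(adjointM, adjointJ, adjointN, kE, opprK).
rewrite !mulmxDl -!scalemxAl !(mulNmx, mulmxN, opprK) !(bilinearE omega_bilinear).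
rewrite !mulmxA.
ring.
Qed.

Definition c_endo B : endo := 3^-1 *:
  (- (3 * m%:R) *: adjoint B + (m%:R - 4) *: (\sum_(a < 3) J a *m B *m J a)
   - 4 *: (\sum_(a < 3) J a *m adjoint B *m J a) - (6 * \tr B)%:M
   + 4 *: \sum_(a < 3) \tr (B *m J a) *: J a).

Lemma c_mapE (A : tangent -> endo) x :
  c_map omega J (p_map omega J A) x = c_endo (A x).
Proof.
rewrite /c_map (funext (fun y => funext (c_formE A x y))) endo_of_form /c_endo; congr (_ *: _); move: (A x) => B.
(* With a as the inner index, the traces of J_b J_a leave only a = b, and the next two terms become
   sums of conjugates by the J_a, one of k and one of J_b, which is fixed. *)
rewrite exchange_big/=.
transitivity (\sum_(b < 3) (- m%:R *: (gJ_action B b *m J b)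
   + 2 *: (J b *m (\sum_(a < 3) J a *m gJ_action B b *m J a))
   + 2 *: (gJ_action B b *m J b)
   + \sum_(a < 3) \tr (gJ_action B b *m J a) *: (J b *m J a))).
  apply: eq_bigr => b _; rewrite !big_split/=; congr (_ + _ + _ + _).
  - rewrite (bigD1 b)//= mxtraceJJ eqxx big1 ?addr0// => a ab.
    by rewrite mxtraceJJ eq_sym (negbTE ab) scale0r.
  - by rewrite mulmx_sumr scaler_sumr; apply: eq_bigr => a _; rewrite !mulmxA.
  - by rewrite -scaler_sumr -mulmx_sumr conjJ_J.
have trK b a : \tr (gJ_action B b *m J a) = - 2 * \tr (B *m (J a *m J b)).
  rewrite /gJ_action mulNmx mulmxDl linearN linearD/=.
  have -> : \tr (adjoint B *m J b *m J a) = \tr (B *m (J a *m J b)).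
    rewrite -tr_adjoint !adjointM adjointK !adjointJ !(mulNmx, mulmxN, opprK).
    by rewrite mulmxA mxtrace_mulC.
  have -> : \tr (J b *m B *m J a) = \tr (B *m (J a *m J b)).
    by rewrite -mulmxA mxtrace_mulC mulmxA.
  ring.
have KJ : \sum_(b < 3) gJ_action B b *m J b
    = 3 *: adjoint B - \sum_(b < 3) J b *m B *m J b.
  rewrite !sum3 /gJ_action !(mulNmx, mulmxDl) -!mulmxA !JE !(mulmxN, mulmx1).
  by apply/matrixP => i j; rewrite !mxE; ring.
have JKJ : \sum_(b < 3) J b *m (\sum_(a < 3) J a *m gJ_action B b *m J a)
   = - (3 *: adjoint B) - 2 *: (\sum_(b < 3) J b *m adjoint B *m J b)
     - \sum_(b < 3) J b *m B *m J b.
  rewrite !sum3 /gJ_action !(mulNmx, mulmxN, mulmxDl, mulmxDr) !mulmxA.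
  rewrite !(JE, mulmxN, mulNmx, mul1mx, mulmx1).
  rewrite -!mulmxA !(JE, mulmxN, mulNmx, mul1mx, mulmx1).
  by apply/matrixP => i j; rewrite !mxE; ring.
(* The three terms a = b give -2 tr B each; the terms a != b give 2 tr(B J_c) J_c, each c arising
   from two ordered pairs. *)
have trKJ : \sum_(b < 3) \sum_(a < 3) \tr (gJ_action B b *m J a) *: (J b *m J a)
   = - (6 * \tr B)%:M + 4 *: \sum_(a < 3) \tr (B *m J a) *: J a.
  rewrite !sum3 !trK !JE !(mulmxN, mulmx1, linearN)/=.
  by apply/matrixP => i j; rewrite !mxE; case: (i == j) => /=; rewrite ?mulr1n ?mulr0n; ring.
rewrite !big_split/= -!scaler_sumr KJ JKJ trKJ.
by apply/matrixP => i j; rewrite !mxE; ring.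
Qed.

End TangentSpace.

Lemma mxtraceN (R : pzRingType) (m : nat) (A : 'M[R]_m) : \tr (- A) = - \tr A.
Proof. exact: raddfN. Qed.

(** * Traces and conjugation sums of an admissible triple *)

Section Trace.
Variables (R : realType) (m : nat) (J : 'I_3 -> 'M[R]_m).
Hypothesis J_triple : admissible_triple J.
Implicit Types B : 'M[R]_m.
Let JE := JE J_triple.

Definition conjJ B := \sum_(a < 3) J a *m B *m J a.

Lemma conjJD A B : conjJ (A + B) = conjJ A + conjJ B.
Proof. by rewrite /conjJ -big_split; apply: eq_bigr => a _; rewrite mulmxDr mulmxDl. Qed.
Lemma conjJZ k B : conjJ (k *: B) = k *: conjJ B.
Proof. by rewrite /conjJ scaler_sumr; apply: eq_bigr => a _; rewrite -scalemxAr -scalemxAl. Qed.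
Lemma conjJN B : conjJ (- B) = - conjJ B.
Proof. by rewrite -scaleN1r conjJZ scaleN1r. Qed.
Lemma conjJ_scalar k : conjJ k%:M = (- 3 * k)%:M.
Proof.
rewrite -[k%:M]scalemx1 conjJZ /conjJ sum3 !mulmx1 !JE.
by apply/matrixP => i j; rewrite !mxE; case: (i == j); rewrite ?mulr1n ?mulr0n; ring.
Qed.

Lemma mxtrace_conjJ B : \tr (conjJ B) = - 3 * \tr B.
Proof.
rewrite /conjJ linear_sum/= sum3.
by rewrite 3!(mxtrace_mulC _ (J _)) !mulmxA !JE !mulNmx !mul1mx linearN; ring.
Qed.

(** [conjJ] is symmetric for the trace pairing and fixes J_b. *)
Lemma mxtrace_conjJ_J B b : \tr (conjJ B *m J b) = \tr (B *m J b).
Proof.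
rewrite -[in RHS](conjJ_J J_triple b) mulmx_suml mulmx_sumr !linear_sum/=.
apply: eq_bigr => a _.
by rewrite -!mulmxA mxtrace_mulC !mulmxA.
Qed.

(** This is - m times the trace-orthogonal projection onto the span of the J_a. *)
Definition traceJ B := \sum_(a < 3) \tr (B *m J a) *: J a.

Lemma conjJ_traceJ B : conjJ (traceJ B) = traceJ B.
Proof.
rewrite /traceJ (big_morph _ conjJD (_ : _ = 0)); last by rewrite -(scale0r 0) conjJZ !scale0r.
by apply: eq_bigr => a _; rewrite conjJZ /conjJ conjJ_J.
Qed.

Lemma mxtrace_traceJ_J B b : \tr (traceJ B *m J b) = - m%:R * \tr (B *m J b).
Proof.
rewrite /traceJ mulmx_suml linear_sum (bigD1 b)//= big1.
  by rewrite addr0 -scalemxAl linearZ/= mxtraceJJ// eqxx mulr1n mulrC.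
by move=> a ab; rewrite -scalemxAl linearZ/= mxtraceJJ// (negbTE ab) mulr0.
Qed.

Lemma pi11E B : pi11 J B = 4^-1 *: (B - conjJ B).
Proof. by []. Qed.

(** As J_a^-1 = - J_a, [pi11] averages the conjugates of B by 1, J_1, J_2, J_3, that is, over the
    quaternion group. *)
Lemma pi11_comm B b : pi11 J B *m J b = J b *m pi11 J B.
Proof.
rewrite /pi11 -scalemxAl -scalemxAr; congr (_ *: _).
rewrite mulmxBl mulmxBr !sum3 !(mulmxDl, mulmxDr) !mulmxA.
move: b; apply: forall3; rewrite !(JE, mulmxN, mulNmx, mul1mx, mulmx1);
  rewrite -!mulmxA !(JE, mulmxN, mulNmx, mul1mx, mulmx1);
  by apply/matrixP => i j; rewrite !mxE; ring.
Qed.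

End Trace.

(** * The component of an endomorphism in so*(2n) + sp(1) *)

Section Correction.
Variables (R : realType) (m : nat).
Local Notation tangent := 'cV[R]_m.
Local Notation endo := 'M[R]_m.
Variables (omega : tangent -> tangent -> R) (J : 'I_3 -> endo).
Hypotheses (omega_bilinear : bilinear_form omega)
  (omega_nondegenerate : Defs.nondegenerate omega)
  (omega_skew : forall X Y, omega Y X = - omega X Y).
Hypothesis J_triple : admissible_triple J.
Hypothesis J_omega : forall a X Y, omega (J a *m X) (J a *m Y) = omega X Y.
Implicit Types (B : endo) (A : tangent -> endo).
Let JE := JE J_triple.
Let AsymE := AsymE omega_bilinear omega_nondegenerate omega_skew.
Let SymE := SymE omega_bilinear omega_nondegenerate omega_skew.
Let adjointK := adjointK omega_bilinear omega_nondegenerate omega_skew.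
Let adjointM := adjointM omega_bilinear omega_nondegenerate.
Let adjointP := adjointP omega_bilinear omega_nondegenerate.
Let adjointJ := adjointJ omega_bilinear omega_nondegenerate J_triple J_omega.
Let tr_adjoint := tr_adjoint omega_bilinear omega_nondegenerate.
Lemma adjoint_conjJ B : adjoint omega (conjJ J B) = conjJ J (adjoint omega B).
Proof. exact: adjoint_sum_conjJ. Qed.
Let conjJK B : conjJ J (conjJ J B) = 3 *: B - 2 *: conjJ J B.
Proof. exact: conjJ_conjJ. Qed.
Let p_mapE := p_mapE omega_bilinear omega_nondegenerate.

Let c_endoE B : c_endo omega J B = 3^-1 *:
  (- (3 * m%:R) *: adjoint omega B + (m%:R - 4) *: conjJ J B
   - 4 *: conjJ J (adjoint omega B) - (6 * \tr B)%:M + 4 *: traceJ J B).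
Proof. by []. Qed.

Let adjoint_scalar k : adjoint omega k%:M = k%:M.
Proof. by rewrite -(scalemx1 _ k) adjointZ adjoint1. Qed.

Let adjoint_traceJ B : adjoint omega (traceJ J B) = - traceJ J B.
Proof.
rewrite adjoint_sum -sumrN; apply: eq_bigr => a _.
by rewrite adjointZ adjointJ scalerN.
Qed.

Let traceJ_adjoint B a : \tr (adjoint omega B *m J a) = - \tr (B *m J a).
Proof.
by rewrite -tr_adjoint adjointM adjointK adjointJ mulNmx linearN/= mxtrace_mulC.
Qed.

(** A normal form: adjoints and [conjJ] are pushed down to scalars, B, its adjoint, the [conjJ] of
    both, and [traceJ] B. *)
Definition c_rules := (adjointD, adjointN, adjointZ, adjoint_scalar, adjoint_traceJ,
  adjointK, adjoint_conjJ, conjJD, conjJN, conjJZ, conjJ_scalar J_triple,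
  conjJ_traceJ J_triple, conjJK).

Lemma mxtrace_c B : \tr (c_endo omega J B) = (8 - 4 * m%:R) * \tr B.
Proof.
rewrite c_endoE !(mxtraceD, mxtraceN, mxtraceZ) mxtrace_scalar.
rewrite !(mxtrace_conjJ J_triple) tr_adjoint.
have -> : \tr (traceJ J B) = 0.
  by rewrite linear_sum big1// => a _; rewrite linearZ/= mxtraceJ// mulr0.
by rewrite -(mulr_natr (6 * _)); field.
Qed.

(** The image of c has no component along the J_a, so the trace terms of [w3] vanish on it. *)
Lemma mxtrace_c_J B a : \tr (c_endo omega J B *m J a) = 0.
Proof.
rewrite c_endoE -scalemxAl linearZ/= !(mulmxDl, mulNmx) -!scalemxAl mul_scalar_mx.
rewrite !(mxtraceD, mxtraceN, mxtraceZ) !(mxtrace_conjJ_J J_triple).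
rewrite traceJ_adjoint mxtrace_traceJ_J// (mxtraceJ J_triple).
by field.
Qed.

(* The A_0 of the file header, for A = B. *)
Definition stabilizer_part B := Sym omega (pi11 J B)
  - \sum_(a < 3) (\tr (B *m J a) / m%:R) *: J a.

Lemma stabilizer_partE B : stabilizer_part B = 2^-1 *: (pi11 J B - adjoint omega (pi11 J B))
  - m%:R^-1 *: traceJ J B.
Proof.
rewrite /stabilizer_part SymE; congr (_ - _).
by rewrite scaler_sumr; apply: eq_bigr => a _; rewrite scalerA mulrC.
Qed.

Lemma adjoint_stabilizer_part B : adjoint omega (stabilizer_part B) = - stabilizer_part B.
Proof.
rewrite stabilizer_partE !c_rules.
by apply/matrixP => i j; rewrite !mxE; ring.
Qed.

(** The so*(2n) part is built from [pi11] B and its adjoint, which commute with J_b; only the sp(1)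
    part is left. *)
Lemma stabilizer_part_comm B b :
  stabilizer_part B *m J b - J b *m stabilizer_part B
  = - m%:R^-1 *: \sum_(a < 3) \tr (B *m J a) *: (J a *m J b - J b *m J a).
Proof.
have S : adjoint omega (pi11 J B) *m J b = J b *m adjoint omega (pi11 J B).
  have := congr1 (adjoint omega) (pi11_comm J_triple B b).
  by rewrite !adjointM adjointJ mulNmx mulmxN => /oppr_inj.
rewrite stabilizer_partE mulmxBl mulmxBr -!scalemxAl -!scalemxAr !(mulmxBl, mulmxBr).
rewrite S pi11_comm//.
rewrite opprD addrACA subrr add0r.
rewrite /traceJ !sum3 !(mulmxDl, mulmxDr) -!scalemxAl -!scalemxAr.
by apply/matrixP => i j; rewrite !mxE; ring.
Qed.

Lemma p_map_sub A A' : p_map omega J (fun x => A x - A' x)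
  = fun x y z u v => p_map omega J A x y z u v - p_map omega J A' x y z u v.
Proof.
apply/funext => x; apply/funext => y; apply/funext => z; apply/funext => u.
apply/funext => v; rewrite !p_mapE -mulrBr -sumrB; congr (_ * _).
apply: eq_bigr => b _; rewrite !(omega_gJ_action omega_bilinear omega_nondegenerate).
by rewrite !mulmxBl !mulmxBr !(bilinearE omega_bilinear); ring.
Qed.

(** As A_0 is skew-adjoint, its action on g_{J_b} is given by the commutator of A_0 with J_b. This
    is an infinitesimal rotation of the triple, under which the sum of the squares of the g_{J_b} is
    invariant. *)
Lemma p_map_stabilizer_part A : p_map omega J (fun x => stabilizer_part (A x))
  = fun x y z u v => 0.
Proof.
apply/funext => x; apply/funext => y; apply/funext => z; apply/funext => u.
apply/funext => v; rewrite p_mapE; apply/eqP; rewrite mulf_eq0; apply/orP; right.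
have KE b : gJ_action omega J (stabilizer_part (A x)) b =
    - m%:R^-1 *: \sum_(a < 3) \tr (A x *m J a) *: (J a *m J b - J b *m J a).
  by rewrite -stabilizer_part_comm /gJ_action adjoint_stabilizer_part mulNmx opprD opprK.
under eq_bigr do rewrite !KE.
rewrite !sum3 !JE !opprK !addNr !scaler0 !addr0 !add0r.
rewrite -!scalemxAl !mulmxDl -!scalemxAl !mulmxDl !mulNmx !(bilinearE omega_bilinear).
by apply/eqP; ring.
Qed.

End Correction.

(** * Inverting c o p on each W_i *)

Section CorrectionFormula.
Variables (R : realType) (n : nat).
Hypothesis n1 : (1 < n)%N.
Local Notation tangent := 'cV[R]_(4 * n).
Local Notation endo := 'M[R]_(4 * n).
Variables (omega : tangent -> tangent -> R) (J : 'I_3 -> endo).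
Hypotheses (omega_bilinear : bilinear_form omega)
  (omega_nondegenerate : Defs.nondegenerate omega)
  (omega_skew : forall X Y, omega Y X = - omega X Y).
Hypothesis J_triple : admissible_triple J.
Hypothesis J_omega : forall a X Y, omega (J a *m X) (J a *m Y) = omega X Y.

Let AsymE := AsymE omega_bilinear omega_nondegenerate omega_skew.
Let SymE := SymE omega_bilinear omega_nondegenerate omega_skew.
Let c_rules := c_rules omega_bilinear omega_nondegenerate omega_skew J_triple J_omega.
Let c_mapE := c_mapE omega_bilinear omega_nondegenerate omega_skew J_triple J_omega.
Let mxtrace_c := mxtrace_c omega_bilinear omega_nondegenerate J_triple.
Let mxtrace_c_J := mxtrace_c_J omega_bilinear omega_nondegenerate omega_skew J_triple J_omega.

Lemma correction_p_map A X : correction omega J (p_map omega J A) X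
  = stabilizer_part omega J (A X) - A X.
Proof.
rewrite /correction /w1 /w2 /w3 /w4 c_mapE; move: (A X) => B.
rewrite [\sum_(a < 3) _]big1 ?addr0; last by move=> a _; rewrite mxtrace_c_J mul0r scale0r.
rewrite mxtrace_c stabilizer_partE// AsymE SymE AsymE /pi11 -!/(conjJ _ _).
rewrite /c_endo -!/(conjJ _ _) -/(traceJ J B) !c_rules.
(* These are the denominators of s; n - 1 is nonzero because n > 1. *)
have n0 : n%:R != 0 :> R by rewrite pnatr_eq0 -lt0n ltnW.
have n1' : n%:R - 1 != 0 :> R by rewrite subr_eq0 pnatr_eq1 neq_ltn n1 orbT.
have n2 : 2 * n%:R - 1 != 0 :> R.
  rewrite subr_eq0 -natrM pnatr_eq1 neq_ltn; apply/orP; right.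
  by rewrite (leq_trans n1)// leq_pmull.
have n3 : n%:R + 1 != 0 :> R by rewrite natr1 pnatr_eq0.
rewrite !natrM.
(* From here the identity is formal: the matrices are independent unknowns, and diagonal entries
   differ from the others only by terms in tr B. *)
move: (adjoint omega B) (conjJ J B) (conjJ J (adjoint omega B)) (traceJ J B) => aB cB caB tB.
apply/matrixP => i j; rewrite !mxE.
case: (i == j); rewrite ?mulr1n ?mulr0n; field; rewrite ?n0 ?n1' ?n2 ?n3//.
Qed.

End CorrectionFormula.

Section FiberTheorem.
Variables (R : realType) (n : nat).
Hypothesis n1 : (1 < n)%N.
Local Notation tangent := 'cV[R]_(4 * n).
Local Notation endo := 'M[R]_(4 * n).
Variables (omega : tangent -> tangent -> R) (J : 'I_3 -> endo).
Hypotheses (omega_bilinear : bilinear_form omega)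
  (omega_nondegenerate : Defs.nondegenerate omega)
  (omega_skew : forall X Y, omega Y X = - omega X Y).
Hypothesis J_triple : admissible_triple J.
Hypothesis J_omega : forall a X Y, omega (J a *m X) (J a *m Y) = omega X Y.

Let AsymE := AsymE omega_bilinear omega_nondegenerate omega_skew.
Let SymE := SymE omega_bilinear omega_nondegenerate omega_skew.
Let c_mapE := c_mapE omega_bilinear omega_nondegenerate omega_skew J_triple J_omega.

Lemma s_map_p_map (A : tangent -> endo) : s_map omega J (p_map omega J A)
  = fun X => A X - stabilizer_part omega J (A X).
Proof.
by apply/funext => X; rewrite /s_map (correction_p_map n1)// opprB.
Qed.

Lemma p_map_s_map (A : tangent -> endo) :
  p_map omega J (s_map omega J (p_map omega J A)) = p_map omega J A.
Proof.
rewrite s_map_p_map p_map_sub// p_map_stabilizer_part//.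
apply/funext => x; apply/funext => y; apply/funext => z; apply/funext => u.
by apply/funext => v; rewrite subr0.
Qed.

Lemma c_map_linear (A : tangent -> endo) : linear A ->
  linear (c_map omega J (p_map omega J A)).
Proof.
move=> Al k x y; rewrite !c_mapE Al /c_endo -!/(conjJ _ _) !(adjointD, adjointZ).
rewrite !(conjJD, conjJZ) !(mxtraceD, mxtraceZ) !sum3 !mulmxDl -!scalemxAl.
rewrite !(mxtraceD, mxtraceZ).
move: (conjJ J (A x)) (conjJ J (A y)) (conjJ J _) (conjJ J _) => ? ? ? ?.
by apply/matrixP => i j; rewrite !mxE; case: (i == j); rewrite ?mulr1n ?mulr0n; ring.
Qed.

Let linearZ' (C : tangent -> endo) (k : R) : linear C -> linear (fun X => k *: C X).
Proof. by move=> Cl a x y; rewrite Cl scalerDr !scalerA mulrC. Qed.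

Lemma s_map_W1234 (A : tangent -> endo) : linear A ->
  W1234 omega J (s_map omega J (p_map omega J A)).
Proof.
move=> Al; have Cl := c_map_linear Al.
set T := p_map omega J A in Cl *; set C := c_map omega J T in Cl.
have pi11Z k B : pi11 J (k *: B) = k *: pi11 J B.
  by rewrite /pi11 -!/(conjJ _ _) conjJZ -scalerBr !scalerA mulrC.
have AsymZ k B : Asym omega (k *: B) = k *: Asym omega B.
  by rewrite !AsymE adjointZ -scalerDr !scalerA mulrC.
have SymZ k B : Sym omega (k *: B) = k *: Sym omega B.
  by rewrite !SymE adjointZ -scalerBr !scalerA mulrC.
(* Each w_i is homogeneous, so its coefficient can be moved into the argument; k C remains linear,
   as [image_of] demands. *)
have im (w : (tangent -> endo) -> tangent -> endo) k :
    (forall k B X, w (fun X => k *: B X) X = k *: w B X) ->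
    image_of w (fun X => k *: w C X).
  by move=> wZ; exists (fun X => k *: C X); [exact: linearZ'|apply/funext => X].
exists (fun X => - (1 / (8 * (2 * n%:R - 1))) *: w1 C X),
  (fun X => - (1 / (8 * (n%:R - 1))) *: w2 omega J C X),
  (fun X => (3 / (16 * n%:R)) *: w3 omega J C X),
  (fun X => - (3 / (8 * (n%:R + 1))) *: w4 omega J C X); split.
- by apply: im => k B X; rewrite /w1 mxtraceZ scalerA mulrA.
- apply: im => k B X; rewrite /w2 pi11Z AsymZ mxtraceZ.
  by rewrite -mulrA -scalerA -scalerBr.
- apply: im => k B X; rewrite /w3 pi11Z -scalerBr SymZ scalerDr; congr (_ + _).
  rewrite scaler_sumr; apply: eq_bigr => a _.
  by rewrite -scalemxAl mxtraceZ scalerA mulrA.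
- by apply: im => k B X; rewrite /w4 pi11Z -scalerBr AsymZ.
- apply/funext => X; rewrite /s_map /correction -/T -/C.
  by rewrite !opprD opprK !scaleNr.
Qed.

End FiberTheorem.

(** * Independence of the admissible basis *)

Section BasisIndependence.
Variables (R : realType) (m : nat).
Hypothesis m0 : (0 < m)%N.
Variables J J' : 'I_3 -> 'M[R]_m.
Hypotheses (J_triple : admissible_triple J) (J'_triple : admissible_triple J')
  (J'J : span3 J' = span3 J).

(** The anticommutators of an admissible triple are -2 delta_ab, so the matrix O expressing J' in J
    is orthogonal, and the diagonal sum of a bilinear f is invariant under orthogonal changes. *)
Lemma admissible_sum_eq (V : lmodType R) (f : 'M[R]_m -> 'M[R]_m -> V) :
  (forall A, linear (f A)) -> (forall B, linear (f ^~ B)) ->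
  \sum_(a < 3) f (J' a) (J' a) = \sum_(a < 3) f (J a) (J a).
Proof.
move=> fr fl.
have frs A (c : 'I_3 -> R) : f A (\sum_b c b *: J b) = \sum_b c b *: f A (J b).
  have f0 : f A 0 = 0 by have := fr A (-1) 0 0; rewrite scaler0 addr0 scaleN1r addNr.
  by elim/big_rec2: _ => [//|b u v _ <-]; rewrite fr.
have fls B (c : 'I_3 -> R) : f (\sum_b c b *: J b) B = \sum_b c b *: f (J b) B.
  have f0 : f 0 B = 0 by have := fl B (-1) 0 0; rewrite scaler0 addr0 scaleN1r addNr.
  by elim/big_rec2: _ => [//|b u v _ <-]; rewrite fl.
have /choice[c cE] : forall a, exists c : 'I_3 -> R, J' a = \sum_b c b *: J b.
  move=> a; have : span3 J (J' a).
    rewrite -J'J; exists (fun b => (b == a)%:R); rewrite (bigD1 a)//= eqxx scale1r.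
    by rewrite big1 ?addr0// => b /negbTE ->; rewrite scale0r.
  by case=> c ->; exists c.
pose O := \matrix_(a, b) c a b.
have anti (J1 : 'I_3 -> 'M[R]_m) : admissible_triple J1 -> forall a b,
    J1 a *m J1 b + J1 b *m J1 a = (- 2 * (a == b)%:R)%:M.
  move=> J1t; apply: forall3; apply: forall3; rewrite !(JE J1t) ?addNr ?subrr/=;
    by apply/matrixP => i j; rewrite !mxE; case: (i == j); rewrite ?mulr1n ?mulr0n; ring.
have OO : O *m O^T = 1%:M.
  apply/matrixP => a b; rewrite !mxE.
  have := anti _ J'_triple a b.
  have -> : J' a *m J' b + J' b *m J' a = (- 2 * \sum_i O a i * O^T i b)%:M.
    transitivity (\sum_i \sum_j (c a i * c b j) *: (J i *m J j + J j *m J i)).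
      have E a1 b1 : J' a1 *m J' b1 = \sum_i \sum_j (c a1 i * c b1 j) *: (J i *m J j).
        rewrite cE [J' b1]cE mulmx_suml; apply: eq_bigr => i _.
        rewrite mulmx_sumr; apply: eq_bigr => j _.
        by rewrite -scalemxAl -scalemxAr scalerA.
      rewrite E (E b) [X in _ + X]exchange_big -big_split; apply: eq_bigr => i _ /=.
      rewrite -big_split; apply: eq_bigr => j _ /=.
      by rewrite (mulrC (c b j)) -scalerDr.
    rewrite mulr_sumr (raddf_sum (@scalar_mx R m)); apply: eq_bigr => i _.
    rewrite (bigD1 i)//= big1 => [|j ji]; last first.
      by rewrite anti// eq_sym (negbTE ji) mulr0 (raddf0 (@scalar_mx R m)) scaler0.
    rewrite anti// eqxx mulr1 addr0 !mxE -scalemx1 scalerA.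
    by rewrite mulrC scalemx1.
  (* Since m > 0, a scalar matrix determines its scalar, read off at the first diagonal entry. *)
  move=> /matrixP /(_ (Ordinal m0) (Ordinal m0)); rewrite !mxE eqxx !mulr1n.
  by move=> /mulfI; apply; rewrite oppr_eq0 pnatr_eq0.
have OO' : O^T *m O = 1%:M by exact: mulmx1C.
transitivity (\sum_a \sum_b \sum_d (c a b * c a d) *: f (J b) (J d)).
  apply: eq_bigr => a _; rewrite cE fls; apply: eq_bigr => b _.
  by rewrite frs scaler_sumr; apply: eq_bigr => d _; rewrite scalerA.
rewrite exchange_big; apply: eq_bigr => b _; rewrite exchange_big/=.
transitivity (\sum_d (b == d)%:R *: f (J b) (J d)).
  apply: eq_bigr => d _; rewrite -scaler_suml; congr (_ *: _).
  have /matrixP /(_ b d) := OO'; rewrite !mxE => <-.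
  by apply: eq_bigr => a _; rewrite !mxE.
rewrite (bigD1 b)//= eqxx scale1r big1 ?addr0// => d; rewrite eq_sym => /negbTE ->.
by rewrite scale0r.
Qed.

Variable omega : 'cV[R]_m -> 'cV[R]_m -> R.
Hypothesis omega_bilinear : bilinear_form omega.

Lemma Phi_basis : Phi omega J' = Phi omega J.
Proof.
apply/funext => y; apply/funext => z; apply/funext => u; apply/funext => v.
apply: (@admissible_sum_eq R^o
  (fun A B => symprod (gJ omega A) (gJ omega B) y z u v)) => ? k ? ?;
  rewrite /symprod /gJ !mulmxDl -!scalemxAl !(bilinearE omega_bilinear)/=;
  by rewrite /GRing.scale/=; ring.
Qed.

Lemma stabilizer_part_basis : stabilizer_part omega J' = stabilizer_part omega J.
Proof.
apply/funext => B; rewrite /stabilizer_part /pi11.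
rewrite (admissible_sum_eq (f := fun A A' => A *m B *m A')).
- congr (_ - _).
  apply: (admissible_sum_eq (f := fun A A' => (\tr (B *m A) / m%:R) *: A')) => A k x y.
    by rewrite scalerDr !scalerA mulrC.
  by rewrite mulmxDr -scalemxAr mxtraceD mxtraceZ mulrDl scalerDl !scalerA mulrA.
- by move=> A k x y; rewrite mulmxDr -scalemxAr.
- by move=> A k x y; rewrite !mulmxDl -!scalemxAl.
Qed.

End BasisIndependence.

(** * Functions of class C^k *)

Section NearEq.
Variables (R : realType) (V W : normedModType R).
Implicit Types (f g : V -> W) (D : set V).

(** The affine approximation of f at p is also one of g, as both agree near p; uniqueness of the
    differential concludes. *)
Let near_diff f g p : {near p, f =1 g} -> differentiable f p ->
  differentiable g p /\ 'd g p = 'd f p :> (V -> W).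
Proof.
move=> fg df; have fgp : f p = g p by exact: nbhs_singleton fg.
have gE : g \o shift p = cst (g p) + 'd f p +o_ 0 id.
  apply/eqaddoP => e e0.
  have /eqaddoP/(_ e e0) := diff_locally df.
  have : \forall h \near 0, f (h + p) = g (h + p).
    have : \forall z \near p, f z = g z by [].
    by rewrite (near_shift 0 p) subr0.
  rewrite !near_simpl => fg0 o; near=> h.
  have : f (h + p) = g (h + p) by near: h.
  have : `|(f \o shift p - (cst (f p) + 'd f p)) h| <= e * `|h| by near: h.
  by rewrite !fctE /= fgp => + E; rewrite E.
have dE : 'd g p = 'd f p :> (V -> W).
  by apply: diff_unique => //; exact: diff_continuous.
split=> //; apply/diff_locallyP; rewrite dE; split=> //; exact: diff_continuous.
Unshelve. all: by end_near. Qed.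

Lemma near_eq_differentiable f g p : {near p, f =1 g} -> differentiable f p ->
  differentiable g p.
Proof. by move=> fg /(near_diff fg)[]. Qed.

Lemma near_eq_diff f g p : {near p, f =1 g} -> differentiable f p ->
  'd g p = 'd f p :> (V -> W).
Proof. by move=> fg /(near_diff fg)[]. Qed.

Lemma open_near_eq D f g p : open D -> D p -> (forall q, D q -> f q = g q) ->
  {near p, f =1 g}.
Proof. by move=> oD Dp fg; apply: filterS (open_nbhs_nbhs (conj oD Dp)). Qed.

Lemma Ck_congr k D f g : open D -> (forall p, D p -> f p = g p) ->
  Ck k D f -> Ck k D g.
Proof.
move=> oD; elim: k f g => [|k IH] f g fg /=.
  move=> cf p Dp; have fgp := open_near_eq oD Dp fg.
  rewrite /prop_for /continuous_at -(fg _ Dp); apply: cvg_trans (cf p Dp).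
  exact: near_eq_cvg.
move=> [df ddf]; split=> [p Dp|v].
  exact: near_eq_differentiable (open_near_eq oD Dp fg) (df p Dp).
apply: IH (ddf v) => p Dp.
by rewrite (near_eq_diff (open_near_eq oD Dp fg))//; exact: df.
Qed.

Lemma Ck_sub k D D' f : D' `<=` D -> Ck k D f -> Ck k D' f.
Proof.
move=> DD; elim: k f => [|k IH] f /=; first by move=> cf p /DD; exact: cf.
by move=> [df ddf]; split=> [p /DD|v]; [exact: df|exact: IH].
Qed.

(** [Ck] is a condition on the total function f at each point of D, so it can be checked on the
    pieces of a cover. *)
Lemma Ck_local k D f :
  (forall p, D p -> exists D', [/\ open D', D' p & Ck k (D `&` D') f]) -> Ck k D f.
Proof.
elim: k f => [|k IH] f /= h.
  by move=> p Dp; have [D' [_ D'p]] := h p Dp; apply.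
split=> [p Dp|v].
  by have [D' [_ D'p [+ _]]] := h p Dp; apply.
by apply: IH => p Dp; have [D' [oD' D'p [_ +]]] := h p Dp; exists D'.
Qed.

Lemma Ck_prev k D f : Ck k.+1 D f -> Ck k D f.
Proof.
elim: k f => [|k IH] f [df ddf].
  by move=> p Dp; apply: differentiable_continuous; exact: df.
by split=> // v; apply: IH; exact: ddf.
Qed.
End NearEq.

Section CkAlgebra.
Variables (R : realType) (V : normedModType R).
Variables (D : set V) (oD : open D).

Section Module.
Variable W : normedModType R.
Implicit Types f g : V -> W.

Lemma Ck_cst k (a : W) : Ck k D (cst a : V -> W).
Proof.
elim: k a => [|k IH] a /=; first by move=> p _; exact: cst_continuous.
split=> [p _|v]; first exact: differentiable_cst.
by apply: (Ck_congr oD _ (IH 0)) => p _; rewrite diff_cst.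
Qed.

Lemma Ck_add k f g : Ck k D f -> Ck k D g -> Ck k D (fun p => f p + g p).
Proof.
elim: k f g => [|k IH] f g /=.
  by move=> cf cg p Dp; apply: continuousD; [exact: cf|exact: cg].
move=> [df ddf] [dg ddg]; split=> [p Dp|v].
  by apply: differentiableD; [exact: df|exact: dg].
apply: (Ck_congr oD _ (IH _ _ (ddf v) (ddg v))) => p Dp.
by rewrite diffD//; [exact: df|exact: dg].
Qed.

Lemma Ck_scalel k (f : V -> R) (w : W) : Ck k D f -> Ck k D (fun p => f p *: w).
Proof.
elim: k f => [|k IH] f /=.
  by move=> cf p Dp; apply: continuousZr_tmp; exact: cf.
move=> [df ddf]; split=> [p Dp|v].
  by apply: differentiableZl; exact: df.
by apply: (Ck_congr oD _ (IH _ (ddf v))) => p Dp; rewrite diffZl//; exact: df.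
Qed.

Lemma Ck_linear (W' : normedModType R) k (L : {linear W -> W'}) f :
  continuous L -> Ck k D f -> Ck k D (fun p => L (f p)).
Proof.
move=> cL; elim: k f => [|k IH] f /=.
  by move=> cf p Dp; apply: continuous_comp; [exact: cf|exact: cL].
move=> [df ddf]; split=> [p Dp|v].
  by apply: differentiable_comp; [exact: df|exact: linear_differentiable].
apply: (Ck_congr oD _ (IH _ (ddf v))) => p Dp.
rewrite (_ : (fun p => L (f p)) = L \o f)//.
rewrite (diff_comp (df p Dp) (linear_differentiable (f p) cL)).
by rewrite /comp diff_lin.
Qed.
End Module.

Implicit Types f g : V -> R.

(** The derivative f dg + g df contains f and g themselves, so the induction also needs them one
    class lower, which [Ck_prev] supplies. *)
Lemma Ck_mul k f g : Ck k D f -> Ck k D g -> Ck k D (fun p => f p * g p).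
Proof.
elim: k f g => [|k IH] f g /=.
  by move=> cf cg p Dp; apply: continuousM; [exact: cf|exact: cg].
move=> Sf Sg; have := Ck_prev Sf; have := Ck_prev Sg.
move: Sf Sg => [df ddf] [dg ddg] Cg Cf; split=> [p Dp|v].
  by apply: differentiableM; [exact: df|exact: dg].
apply: (Ck_congr oD _ (Ck_add (IH _ _ Cf (ddg v)) (IH _ _ Cg (ddf v)))) => p Dp.
by rewrite diffM//; [exact: df|exact: dg].
Qed.

Lemma Ck_inv k f : (forall p, D p -> f p != 0) -> Ck k D f ->
  Ck k D (fun p => (f p)^-1).
Proof.
move=> f0; elim: k => [|k IH].
  by move=> cf p Dp; apply: continuousV; [exact: f0|exact: cf].
move=> Sf; have Vf := IH (Ck_prev Sf); have [df ddf] := Sf; split=> [p Dp|v].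
  by apply: differentiableV; [exact: df|exact: f0].
have C := Ck_mul (Ck_mul (Ck_cst k (-1 : R)) (Ck_mul Vf Vf)) (ddf v).
apply: (Ck_congr oD _ C) => p Dp.
rewrite diffV//; [|exact: df|exact: f0].
by rewrite mulN1r -expr2 -exprVn.
Qed.

Lemma Ck_sum k (I : Type) (r : seq I) (F : I -> V -> R) :
  (forall i, Ck k D (F i)) -> Ck k D (fun p => \sum_(i <- r) F i p).
Proof.
move=> CF; elim: r => [|i r IH].
  by under eq_fun do rewrite big_nil; exact: Ck_cst.
by under eq_fun do rewrite big_cons; exact: Ck_add.
Qed.

Lemma Ck_prod k (I : Type) (r : seq I) (F : I -> V -> R) :
  (forall i, Ck k D (F i)) -> Ck k D (fun p => \prod_(i <- r) F i p).
Proof.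
move=> CF; elim: r => [|i r IH].
  by under eq_fun do rewrite big_nil; exact: Ck_cst.
by under eq_fun do rewrite big_cons; exact: Ck_mul.
Qed.

Lemma Ck_det k m (A : V -> 'M[R]_m) :
  (forall i j, Ck k D (fun p => A p i j)) -> Ck k D (fun p => \det (A p)).
Proof.
move=> CA; apply: Ck_sum => s; apply: Ck_mul; first exact: Ck_cst.
exact: Ck_prod.
Qed.

(** Cramer's rule: the entries are cofactors divided by the determinant, which does not vanish on
    D. *)
Lemma Ck_invmx k m (A : V -> 'M[R]_m) : (forall p, D p -> A p \in unitmx) ->
  (forall i j, Ck k D (fun p => A p i j)) ->
  forall i j, Ck k D (fun p => invmx (A p) i j).
Proof.
move=> Au CA i j.
suff C : Ck k D (fun p => (\det (A p))^-1 * \adj (A p) i j).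
  by apply: (Ck_congr oD _ C) => p Dp; rewrite /invmx Au// [RHS]mxE.
apply: Ck_mul.
  apply: Ck_inv (Ck_det CA) => p /Au; by rewrite unitmxE unitfE.
under eq_fun do rewrite mxE /cofactor.
apply: Ck_mul; first exact: Ck_cst.
apply: Ck_det => i' j'; under eq_fun do rewrite !mxE.
exact: CA.
Qed.

Lemma Ck_col k m (f : V -> 'cV[R]_m) :
  Ck k D f <-> forall i, Ck k D (fun p => f p i 0).
Proof.
split=> [Cf i|Cf].
  have @L : {linear 'cV[R]_m -> R}.
    by exists (fun N : 'cV[R]_m => N i 0); do 2![eexists]; do ?[constructor];
       rewrite ?mxE// => ? *; rewrite ?mxE//; move=> ?; rewrite !mxE.
  by apply: (@Ck_linear _ _ _ L _ _ Cf); exact: coord_continuous.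
have -> : f = fun p => \sum_i f p i 0 *: delta_mx i 0.
  apply/funext => p; rewrite {1}[f p]matrix_sum_delta.
  by apply: eq_bigr => i _; rewrite big_ord1.
have : forall i, Ck k D (fun p => f p i 0 *: (delta_mx i 0 : 'cV[R]_m)).
  by move=> i; exact: Ck_scalel.
elim: (index_enum _) => [|i r IH] C.
  by under eq_fun do rewrite big_nil; exact: Ck_cst.
by under eq_fun do rewrite big_cons; apply: Ck_add => //; exact: IH.
Qed.

End CkAlgebra.

Lemma diff_comp_apply (R : realType) (U V W : normedModType R) (f : U -> V)
  (g : V -> W) x y v : f x = y -> differentiable f x -> differentiable g y ->
  'd (g \o f) x v = 'd g y ('d f x v).
Proof. by move=> <- df dg; rewrite diff_comp. Qed.

Section DiffApply.
Variables (R : realType) (V W : normedModType R) (p v : V).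

Lemma near_eq_diff_apply (f g : V -> W) : {near p, f =1 g} ->
  differentiable f p -> 'd g p v = 'd f p v.
Proof. by move=> fg df; rewrite (near_eq_diff fg df). Qed.

Lemma diffD_apply (f g : V -> W) : differentiable f p -> differentiable g p ->
  'd (fun x => f x + g x) p v = 'd f p v + 'd g p v.
Proof. by move=> df dg; rewrite diffD. Qed.

Lemma diffM_apply (f g : V -> R) : differentiable f p -> differentiable g p ->
  'd (fun x => f x * g x) p v = f p * 'd g p v + g p * 'd f p v.
Proof. by move=> df dg; rewrite diffM. Qed.
End DiffApply.

Lemma diff_sum_std (R : realType) (m : nat) (f : 'cV[R]_m -> R) p v :
  'd f p v = \sum_i v i 0 * 'd f p (std R i).
Proof.
rewrite {1}[v]matrix_sum_delta linear_sum; apply: eq_bigr => i _.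
by rewrite big_ord1 linearZ.
Qed.

(** * Smooth functions, fields and endomorphisms of a manifold *)

Section Manifold.
Variables (R : realType) (m : nat) (M : topologicalType) (S : manifold R m M).
Local Notation tangent := 'cV[R]_m.
Local Notation at_ := (chart_at S).
Implicit Types (U V : set M) (c d e : chart R m M) (f g : M -> R)
  (X Y Z : M -> tangent) (p : M).

Lemma chart_image_open c U : open U -> open (chart_image c U).
Proof.
move=> oU; rewrite openE => q [cq Uq]; apply: filterI.
  by apply: open_nbhs_nbhs; split=> //; exact: chart_cod_open.
by apply: (chart_inv_continuous cq); apply: open_nbhs_nbhs; split.
Qed.

Arguments chart_image_open c {U} _.

Lemma chart_image_fun c U p : chart_dom c p -> U p -> chart_image c U (c p).
Proof. by move=> cp Up; split; [exact: chart_funP|rewrite /preimage/= chart_funK]. Qed.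

Lemma chart_imageS c U V : U `<=` V -> chart_image c U `<=` chart_image c V.
Proof. by move=> UV q [cq Uq]; split=> //; exact: UV. Qed.

Let changeE c d p v : change c d p v = 'd (d \o chart_inv c) (c p) v.
Proof. by []. Qed.

Lemma change_add c d p v w : change c d p (v + w) = change c d p v + change c d p w.
Proof. exact: linearD. Qed.
Lemma change_scale c d p k v : change c d p (k *: v) = k *: change c d p v.
Proof. exact: linearZ. Qed.
Lemma change_sum c d p (I : Type) (r : seq I) (F : I -> tangent) :
  change c d p (\sum_(i <- r) F i) = \sum_(i <- r) change c d p (F i).
Proof. exact: linear_sum. Qed.

Definition change_mx c d p : 'M[R]_m := \matrix_(i, j) change c d p (std R j) i 0.

Lemma col_sum_std (v : tangent) : v = \sum_i v i 0 *: std R i.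
Proof.
by rewrite {1}[v]matrix_sum_delta; apply: eq_bigr => i _; rewrite big_ord1.
Qed.

Lemma change_mxE c d p v : change c d p v = change_mx c d p *m v.
Proof.
rewrite {1}(col_sum_std v) change_sum; apply/colP => i; rewrite summxE [RHS]mxE.
by apply: eq_bigr => j _; rewrite change_scale !mxE mulrC.
Qed.

Lemma transition_smooth c d : atlas S c -> atlas S d ->
  Cinfty (chart_image c (chart_dom d)) (d \o chart_inv c).
Proof. exact: atlas_compatible. Qed.

Lemma smooth_differentiable (W : normedModType R) c U (f : tangent -> W) p :
  Cinfty (chart_image c U) f -> chart_dom c p -> U p -> differentiable f (c p).
Proof. by move=> /(_ 1%N)[+ _] cp Up; apply; exact: chart_image_fun. Qed.

Lemma transition_differentiable c d p : atlas S c -> atlas S d ->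
  chart_dom c p -> chart_dom d p -> differentiable (d \o chart_inv c) (c p).
Proof.
by move=> Sc Sd cp dp; apply: (smooth_differentiable (transition_smooth Sc Sd)).
Qed.

(** The chain rule for f o c^-1 = (f o d^-1) o (d o c^-1), an equality that holds only near c p. *)
Let diff_chart (W : normedModType R) (f : M -> W) c d p v :
  atlas S c -> atlas S d -> chart_dom c p -> chart_dom d p ->
  differentiable (f \o chart_inv d) (d p) ->
  'd (f \o chart_inv c) (c p) v = 'd (f \o chart_inv d) (d p) (change c d p v).
Proof.
move=> Sc Sd cp dp df.
have dcp : (d \o chart_inv c) (c p) = d p by rewrite /= chart_funK.
have dt := transition_differentiable Sc Sd cp dp.
have dft : differentiable ((f \o chart_inv d) \o (d \o chart_inv c)) (c p).
  by apply: differentiable_comp dt _; rewrite dcp.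
transitivity ('d ((f \o chart_inv d) \o (d \o chart_inv c)) (c p) v).
  apply: near_eq_diff_apply dft.
  apply: (@open_near_eq _ _ _ (chart_image c (chart_dom d))).
  - by apply: chart_image_open; exact: chart_dom_open.
  - exact: chart_image_fun.
  - by move=> q [cq dq] /=; rewrite chart_funK.
exact: diff_comp_apply dcp dt df.
Qed.

Lemma change_comp c d e p v : atlas S c -> atlas S d -> atlas S e ->
  chart_dom c p -> chart_dom d p -> chart_dom e p ->
  change d e p (change c d p v) = change c e p v.
Proof.
move=> Sc Sd Se cp dp ep; rewrite [RHS]changeE (diff_chart _ Sc Sd)//.
exact: transition_differentiable.
Qed.

Lemma change_id c p v : chart_dom c p -> change c c p v = v.
Proof.
move=> cp; rewrite changeE (@near_eq_diff _ _ _ id (c \o chart_inv c)).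
- rewrite (_ : 'd id (c p) = id :> (tangent -> tangent))//.
  by apply: (@diff_lin _ _ _ idfun) => q; exact: cvg_id.
- apply: (@open_near_eq _ _ _ (chart_cod c)).
  + exact: chart_cod_open.
  + exact: chart_funP.
  + by move=> q cq /=; rewrite chart_invK.
- by apply: (@linear_differentiable _ _ _ idfun) => q; exact: cvg_id.
Qed.

Lemma change_mx_inv c d p : atlas S c -> atlas S d -> chart_dom c p ->
  chart_dom d p -> change_mx c d p *m change_mx d c p = 1%:M.
Proof.
move=> Sc Sd cp dp; apply/matrixP => i j.
have := change_comp (std R j) Sd Sc Sd dp cp dp; rewrite change_id//.
rewrite !change_mxE mulmxA => /colP/(_ i).
by rewrite /std -colE !mxE eqxx andbT.
Qed.

Lemma change_mx_unit c d p : atlas S c -> atlas S d -> chart_dom c p ->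
  chart_dom d p -> change_mx c d p \in unitmx.
Proof.
move=> Sc Sd cp dp; have h := change_mx_inv Sc Sd cp dp.
exact: (mulmx1_unit h).1.
Qed.

Lemma change_mx_smooth c d i j : atlas S c -> atlas S d ->
  Cinfty (chart_image c (chart_dom d))
    (fun q => change_mx c d (chart_inv c q) i j).
Proof.
move=> Sc Sd k; have oD := chart_image_open c (@chart_dom_open _ _ _ d).
have [_ /(_ (std R j))] := transition_smooth Sc Sd k.+1.
move=> /(Ck_col oD)/(_ i); apply: Ck_congr => // q [cq dq].
by rewrite mxE /change chart_invK.
Qed.

Lemma atlas_at p : atlas S (at_ p). Proof. exact: chart_at_atlas. Qed.
Lemma dom_at p : chart_dom (at_ p) p. Proof. exact: chart_at_dom. Qed.
Hint Resolve atlas_at dom_at : core.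

Definition chart_coord c (i : 'I_m) Y p : R := change (at_ p) c p (Y p) i 0.
(** The i-th coordinate vector field of the chart c, written at each point in the preferred chart of
    that point. *)
Definition frame c (i : 'I_m) p : tangent := change c (at_ p) p (std R i).

Lemma smooth_fieldE U Y : open U -> smooth_field S U Y <->
  forall c, atlas S c -> forall i, Cinfty (chart_image c U) (chart_coord c i Y \o chart_inv c).
Proof.
move=> oU; split=> [sY c Sc i k|sY c Sc k].
  have oD := chart_image_open c oU.
  by have /(Ck_col oD)/(_ i) := sY c Sc k.
by apply/(Ck_col (chart_image_open c oU)) => i; exact: sY.
Qed.

Lemma coord_change c d i Y p : atlas S c -> atlas S d ->
  chart_dom c p -> chart_dom d p ->
  chart_coord d i Y p = \sum_j change_mx c d p i j * chart_coord c j Y p.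
Proof.
move=> Sc Sd cp dp.
rewrite /chart_coord -(@change_comp (at_ p) c d p)// [change c d p _]change_mxE.
by rewrite mxE.
Qed.

Lemma field_frame c Y p : atlas S c -> chart_dom c p ->
  Y p = \sum_i chart_coord c i Y p *: frame c i p.
Proof.
move=> Sc cp; rewrite -[LHS](@change_id (at_ p) p)//.
rewrite -(@change_comp (at_ p) c (at_ p) p)// {1}(col_sum_std (change (at_ p) c p (Y p))).
by rewrite change_sum; apply: eq_bigr => i _; rewrite change_scale.
Qed.

Lemma smooth_fun_sub U V f : V `<=` U -> smooth_fun S U f -> smooth_fun S V f.
Proof. by move=> VU sf c Sc k; apply: Ck_sub (sf c Sc k); exact: chart_imageS. Qed.

Lemma smooth_field_sub U V Y : V `<=` U -> smooth_field S U Y -> smooth_field S V Y.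
Proof. by move=> VU sf c Sc k; apply: Ck_sub (sf c Sc k); exact: chart_imageS. Qed.

Lemma smooth_fun_congr U f g : open U -> (forall p, U p -> f p = g p) ->
  smooth_fun S U f -> smooth_fun S U g.
Proof.
move=> oU fg sf c Sc k; apply: Ck_congr (sf c Sc k); first exact: chart_image_open.
by move=> q [_ Uq]; exact: fg.
Qed.

Lemma smooth_field_congr U Y Z : open U -> (forall p, U p -> Y p = Z p) ->
  smooth_field S U Y -> smooth_field S U Z.
Proof.
move=> oU fg sf c Sc k; apply: Ck_congr (sf c Sc k); first exact: chart_image_open.
by move=> q [_ Uq]; rewrite fg.
Qed.

Lemma smooth_fun_local U f :
  (forall p, U p -> exists V, [/\ open V, V p & smooth_fun S (U `&` V) f]) ->
  smooth_fun S U f.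
Proof.
move=> h c Sc k; apply: Ck_local => q [cq Uq].
have [V [oV Vq sf]] := h _ Uq; exists (chart_image c V); split=> //.
  exact: chart_image_open.
by apply: Ck_sub (sf c Sc k) => q' [[? ?] [? ?]].
Qed.

Lemma smooth_field_local U Y :
  (forall p, U p -> exists V, [/\ open V, V p & smooth_field S (U `&` V) Y]) ->
  smooth_field S U Y.
Proof.
move=> h c Sc k; apply: Ck_local => q [cq Uq].
have [V [oV Vq sf]] := h _ Uq; exists (chart_image c V); split=> //.
  exact: chart_image_open.
by apply: Ck_sub (sf c Sc k) => q' [[? ?] [? ?]].
Qed.

Lemma smooth_fun_cst U (k : R) : open U -> smooth_fun S U (cst k).
Proof. by move=> oU c Sc l; apply: (@Ck_cst _ _ _ (chart_image_open c oU)). Qed.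

Lemma smooth_funD U f g : open U -> smooth_fun S U f -> smooth_fun S U g ->
  smooth_fun S U (fun p => f p + g p).
Proof.
by move=> oU sf sg c Sc k; apply: (Ck_add (chart_image_open c oU)); [exact: sf|exact: sg].
Qed.

Lemma smooth_funM U f g : open U -> smooth_fun S U f -> smooth_fun S U g ->
  smooth_fun S U (fun p => f p * g p).
Proof.
by move=> oU sf sg c Sc k; apply: (Ck_mul (chart_image_open c oU)); [exact: sf|exact: sg].
Qed.

Lemma smooth_fun_scale U k f : open U -> smooth_fun S U f ->
  smooth_fun S U (fun p => k * f p).
Proof. by move=> oU; apply: (smooth_funM (f := cst k)) => //; exact: smooth_fun_cst. Qed.

Lemma smooth_fun_opp U f : open U -> smooth_fun S U f ->
  smooth_fun S U (fun p => - f p).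
Proof.
move=> oU sf; apply: (smooth_fun_congr oU _ (smooth_fun_scale (-1) oU sf)) => p _.
by rewrite mulN1r.
Qed.

Lemma smooth_funB U f g : open U -> smooth_fun S U f -> smooth_fun S U g ->
  smooth_fun S U (fun p => f p - g p).
Proof. by move=> oU sf sg; apply: smooth_funD => //; exact: smooth_fun_opp. Qed.

Lemma smooth_fun_sum U (I : Type) (r : seq I) (F : I -> M -> R) : open U ->
  (forall i, smooth_fun S U (F i)) -> smooth_fun S U (fun p => \sum_(i <- r) F i p).
Proof.
move=> oU sF c Sc k; apply: (Ck_sum (chart_image_open c oU)) => i; exact: sF.
Qed.

Lemma smooth_fieldD U Y Z : open U -> smooth_field S U Y -> smooth_field S U Z ->
  smooth_field S U (fun p => Y p + Z p).
Proof.
move=> oU sf sg c Sc k; have oD := chart_image_open c oU.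
apply: Ck_congr (Ck_add oD (sf c Sc k) (sg c Sc k)) => // q _.
by rewrite change_add.
Qed.

Lemma smooth_fieldZ U f Y : open U -> smooth_fun S U f -> smooth_field S U Y ->
  smooth_field S U (fun p => f p *: Y p).
Proof.
move=> oU sf /(smooth_fieldE _ oU) sY; apply/smooth_fieldE => // c Sc i k.
have oD := chart_image_open c oU.
apply: Ck_congr (Ck_mul oD (sf c Sc k) (sY c Sc i k)) => // q _.
by rewrite /chart_coord /= change_scale mxE.
Qed.

Lemma smooth_field_scale U k Y : open U -> smooth_field S U Y ->
  smooth_field S U (fun p => k *: Y p).
Proof. by move=> oU; apply: (smooth_fieldZ (f := cst k)) => //; exact: smooth_fun_cst. Qed.

Lemma smooth_fieldB U Y Z : open U -> smooth_field S U Y -> smooth_field S U Z ->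
  smooth_field S U (fun p => Y p - Z p).
Proof.
move=> oU sY sZ; have sZ' := smooth_field_scale (-1) oU sZ.
by apply: (smooth_field_congr oU _ (smooth_fieldD oU sY sZ')) => p _; rewrite scaleN1r.
Qed.

Lemma smooth_field_sum U (I : Type) (r : seq I) (F : I -> M -> tangent) : open U ->
  (forall i, smooth_field S U (F i)) ->
  smooth_field S U (fun p => \sum_(i <- r) F i p).
Proof.
move=> oU sF; elim: r => [|i r IH].
  apply: (smooth_field_congr oU (Y := fun p => 0 *: 0)) => [p _|].
    by rewrite big_nil scaler0.
  move=> c Sc k; have oD := chart_image_open c oU.
  apply: (Ck_congr oD _ (@Ck_cst _ _ _ oD _ k 0)) => q _.
  by rewrite change_scale scale0r.
by under eq_fun do rewrite big_cons; apply: (smooth_fieldD oU (sF i) IH).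
Qed.

Lemma coord_smooth U c i Y : open U -> atlas S c -> smooth_field S U Y ->
  smooth_fun S (U `&` chart_dom c) (chart_coord c i Y).
Proof.
move=> oU Sc /(smooth_fieldE _ oU) sY d Sd k.
have oV : open (U `&` chart_dom c) by apply: openI => //; exact: chart_dom_open.
have oD := chart_image_open d oV.
have C : Ck k (chart_image d (U `&` chart_dom c)) (fun q =>
    \sum_j change_mx d c (chart_inv d q) i j * chart_coord d j Y (chart_inv d q)).
  apply: Ck_sum => // j; apply: Ck_mul => //.
    by apply: Ck_sub (change_mx_smooth i j Sd Sc k) => q [? []].
  by apply: Ck_sub (sY d Sd j k) => q [? []].
apply: (Ck_congr oD _ C) => q [dq [Uq cq]] /=.
by rewrite -coord_change//; exact: chart_invP.
Qed.

(** Read in a chart d, the components are entries of the Jacobian of d o c^-1 taken as functions on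
    the image of d. There the smooth Jacobian is that of c o d^-1, so they are obtained by matrix
    inversion. *)
Lemma frame_smooth c i : atlas S c -> smooth_field S (chart_dom c) (frame c i).
Proof.
move=> Sc; have oU := @chart_dom_open _ _ _ c.
apply/smooth_fieldE => // d Sd j k; have oD := chart_image_open d oU.
have u q : chart_image d (chart_dom c) q -> change_mx d c (chart_inv d q) \in unitmx.
  move=> [dq cq].
  exact: change_mx_unit Sd Sc (chart_invP dq) cq.
have C := Ck_invmx oD u (fun i j => change_mx_smooth i j Sd Sc k) j i.
apply: (Ck_congr oD _ C) => q Dq; have [dq cq] := Dq.
rewrite /chart_coord /frame /= change_comp//; last exact: chart_invP.
have := change_mx_inv Sd Sc (chart_invP dq) cq.
move=> /(congr1 (mulmx (invmx (change_mx d c (chart_inv d q))))).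
by rewrite mulKmx ?u// mulmx1 => <-; rewrite mxE.
Qed.

Lemma smooth_near_differentiable f c p : atlas S c -> chart_dom c p ->
  smooth_fun_near S p f -> differentiable (f \o chart_inv c) (c p).
Proof. by move=> Sc cp [U [oU Up sf]]; exact: smooth_differentiable (sf c Sc) cp Up. Qed.

Lemma dfunE f c p v : atlas S c -> chart_dom c p -> smooth_fun_near S p f ->
  dfun S f p v = 'd (f \o chart_inv c) (c p) (change (at_ p) c p v).
Proof. by move=> Sc cp sf; apply: diff_chart => //; exact: smooth_near_differentiable. Qed.

Lemma dfun_coord f c p q v : atlas S c -> chart_dom c p -> c p = q ->
  smooth_fun_near S p f ->
  dfun S f p v = \sum_j change (at_ p) c p v j 0 * 'd (f \o chart_inv c) q (std R j).
Proof. by move=> Sc cp <- sf; rewrite (dfunE _ Sc cp sf); exact: diff_sum_std. Qed.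

Lemma dfun_congr U f g p v : open U -> U p -> (forall q, U q -> f q = g q) ->
  smooth_fun_near S p f -> dfun S f p v = dfun S g p v.
Proof.
move=> oU Up fg sf; apply/esym; rewrite /dfun.
apply: near_eq_diff_apply; last exact: smooth_near_differentiable.
apply: (open_near_eq (chart_image_open (at_ p) oU)); first exact: chart_image_fun.
by move=> q [_ Uq]; exact: fg.
Qed.

Lemma dfunD f g p v : smooth_fun_near S p f -> smooth_fun_near S p g ->
  dfun S (fun q => f q + g q) p v = dfun S f p v + dfun S g p v.
Proof.
move=> /(smooth_near_differentiable (atlas_at p) (dom_at p)) df.
move=> /(smooth_near_differentiable (atlas_at p) (dom_at p)) dg.
exact: diffD_apply.
Qed.

Lemma dfunM f g p v : smooth_fun_near S p f -> smooth_fun_near S p g ->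
  dfun S (fun q => f q * g q) p v = f p * dfun S g p v + g p * dfun S f p v.
Proof.
move=> /(smooth_near_differentiable (atlas_at p) (dom_at p)) df.
move=> /(smooth_near_differentiable (atlas_at p) (dom_at p)) dg.
by rewrite [LHS](diffM_apply _ df dg) /= !chart_funK.
Qed.

Lemma dfun_cst (k : R) p v : dfun S (cst k) p v = 0.
Proof. by rewrite /dfun (_ : _ \o _ = cst k)// diff_cst. Qed.

Lemma dfun_linear f p : linear (dfun S f p : tangent -> R^o).
Proof. by move=> k v w; rewrite /dfun linearP. Qed.

(** [dfun] refers to the preferred chart of each point, which need not vary continuously; the
    derivative is first rewritten in the fixed chart c. *)
Lemma dfun_smooth U f X : open U -> smooth_fun S U f -> smooth_field S U X ->
  smooth_fun S U (fun p => dfun S f p (X p)).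
Proof.
move=> oU sf /(smooth_fieldE _ oU) sX c Sc k; have oD := chart_image_open c oU.
have C : Ck k (chart_image c U) (fun q =>
    \sum_j chart_coord c j X (chart_inv c q) * 'd (f \o chart_inv c) q (std R j)).
  apply: Ck_sum => // j; apply: Ck_mul => //; first exact: sX.
  by have [_ /(_ (std R j))] := sf c Sc k.+1.
apply: (Ck_congr oD _ C) => q [cq Uq] /=.
by apply/esym/dfun_coord => //; [exact: chart_invP|exact: chart_invK|exists U].
Qed.

End Manifold.
Arguments chart_image_open {R m M} c {U} _.

(** * Smooth endomorphisms and forms, and derivations at a point *)

Section Tensors.
Variables (R : realType) (m : nat) (M : topologicalType) (S : manifold R m M).
Local Notation tangent := 'cV[R]_m.
Local Notation at_ := (chart_at S).
Implicit Types (U V : set M) (f g : M -> R) (X Y Z : M -> tangent) (x p : M)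
  (A B : M -> 'M[R]_m).
Local Hint Resolve atlas_at dom_at : core.

Lemma smooth_endo_sub U V A : V `<=` U -> smooth_endo S U A -> smooth_endo S V A.
Proof. by move=> VU sA V' X oV' V'V; apply: sA => //; exact: subset_trans VU. Qed.

Lemma smooth_endoD U A B : smooth_endo S U A -> smooth_endo S U B ->
  smooth_endo S U (fun p => A p + B p).
Proof.
move=> sA sB V X oV VU sX; under eq_fun do rewrite mulmxDl.
exact: (smooth_fieldD oV (sA _ _ oV VU sX) (sB _ _ oV VU sX)).
Qed.

Lemma smooth_endoM U A B : smooth_endo S U A -> smooth_endo S U B ->
  smooth_endo S U (fun p => A p *m B p).
Proof.
move=> sA sB V X oV VU sX; under eq_fun do rewrite -mulmxA.
exact: (sA _ _ oV VU (sB _ _ oV VU sX)).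
Qed.

Lemma smooth_endoZ U f A : smooth_fun S U f -> smooth_endo S U A ->
  smooth_endo S U (fun p => f p *: A p).
Proof.
move=> sf sA V X oV VU sX; under eq_fun do rewrite -scalemxAl.
exact: (smooth_fieldZ oV (smooth_fun_sub VU sf) (sA _ _ oV VU sX)).
Qed.

Lemma smooth_endo_scale U (k : R) A : smooth_endo S U A ->
  smooth_endo S U (fun p => k *: A p).
Proof.
move=> sA V X oV VU sX; under eq_fun do rewrite -scalemxAl.
exact: (smooth_field_scale k oV (sA _ _ oV VU sX)).
Qed.

Lemma smooth_endoB U A B : smooth_endo S U A -> smooth_endo S U B ->
  smooth_endo S U (fun p => A p - B p).
Proof.
move=> sA sB; under eq_fun do rewrite -scaleN1r.
exact: (smooth_endoD sA (smooth_endo_scale (-1) sB)).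
Qed.

Lemma smooth_endo_sum U (I : Type) (r : seq I) (F : I -> M -> 'M[R]_m) :
  (forall i, smooth_endo S U (F i)) ->
  smooth_endo S U (fun p => \sum_(i <- r) F i p).
Proof.
move=> sF V X oV VU sX; under eq_fun do rewrite mulmx_suml.
exact: (smooth_field_sum r oV (fun i => sF i _ _ oV VU sX)).
Qed.

Lemma frame_mx c i p : frame S c i p = change_mx c (at_ p) p *m std R i.
Proof. exact: change_mxE. Qed.

Lemma coord_mx c i X p : chart_coord S c i X p = (change_mx (at_ p) c p *m X p) i 0.
Proof. by rewrite -change_mxE. Qed.

(** Near x the trace is computed in the coordinate frame of one chart, to which it passes by
    conjugation with the change of coordinates. *)
Lemma smooth_trace U A : open U -> smooth_endo S U A ->
  smooth_fun S U (fun p => \tr (A p)).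
Proof.
move=> oU sA; apply: smooth_fun_local => x Ux.
have oV := @chart_dom_open _ _ _ (at_ x).
exists (chart_dom (at_ x)); split=> //.
have oUV : open (U `&` chart_dom (at_ x)) by exact: openI.
have s : smooth_fun S (U `&` chart_dom (at_ x)) (fun p =>
    \sum_i chart_coord S (at_ x) i (fun q => A q *m frame S (at_ x) i q) p).
  apply: smooth_fun_sum => // i.
  have sF : smooth_field S (U `&` chart_dom (at_ x)) (fun q => A q *m frame S (at_ x) i q).
    apply: sA => //; apply: smooth_field_sub (frame_smooth i (atlas_at S x)).
    exact: subIsetr.
  have := coord_smooth i oUV (atlas_at S x) sF.
  by apply: smooth_fun_sub => p [? ?]; split.
apply: (smooth_fun_congr oUV _ s) => p [Up xp].
transitivity (\tr (change_mx (at_ p) (at_ x) p *m (A p *m change_mx (at_ x) (at_ p) p))).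
  apply: eq_bigr => i _; rewrite coord_mx frame_mx !mulmxA.
  by rewrite /std -colE mxE.
by rewrite mxtrace_mulC -mulmxA (change_mx_inv (atlas_at S x) (atlas_at S p))// mulmx1.
Qed.

Section Form.
Variable omega : M -> tangent -> tangent -> R.
Hypotheses (omega_smooth : smooth_form2 S omega)
  (omega_bilinear : forall x, bilinear_form (omega x))
  (omega_nondegenerate : forall x, Defs.nondegenerate (omega x)).

(* Nondegeneracy: the components of Z in a chart solve a linear system whose
   coefficients and right-hand side are smooth. *)
Lemma smooth_field_omega U Z : open U ->
  (forall V W, open V -> V `<=` U -> smooth_field S V W ->
    smooth_fun S V (fun p => omega p (Z p) (W p))) ->
  smooth_field S U Z.
Proof.
move=> oU h; apply/smooth_fieldE => // c Sc i k.
have oc := @chart_dom_open _ _ _ c.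
have oV : open (U `&` chart_dom c) by exact: openI.
have UV : chart_image c U `<=` chart_image c (U `&` chart_dom c).
  by move=> q [cq Uq]; split=> //; split=> //; exact: chart_invP.
have oD := chart_image_open c oU.
have sF j : smooth_field S (U `&` chart_dom c) (frame S c j).
  by apply: smooth_field_sub (frame_smooth j Sc); exact: subIsetr.
pose G q : 'M[R]_m := \matrix_(a, b)
  omega (chart_inv c q) (frame S c a (chart_inv c q)) (frame S c b (chart_inv c q)).
pose hh q : 'rV[R]_m := \row_j
  omega (chart_inv c q) (Z (chart_inv c q)) (frame S c j (chart_inv c q)).
(* The matrix of omega in the coordinate frame is congruent to its Gram matrix in the preferred
   chart. *)
have Gu q : chart_image c U q -> G q \in unitmx.
  move=> [cq _]; set p := chart_inv c q; have cp : chart_dom c p by exact: chart_invP.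
  pose P := change_mx c (at_ p) p.
  have -> : G q = P^T *m gram (omega p) *m P.
    rewrite -[RHS]gram_form; apply/matrixP => a b; rewrite [LHS]mxE [RHS]mxE -/p !frame_mx.
    by rewrite bilinear_gram// trmx_mul !mulmxA.
  have Pu : P \in unitmx by apply: (change_mx_unit Sc).
  by rewrite !unitmx_mul unitmx_tr gram_unit// Pu.
have C : Ck k (chart_image c U) (fun q => (hh q *m invmx (G q)) 0 i).
  under eq_fun do rewrite mxE; apply: Ck_sum => // j; apply: Ck_mul => //.
    under eq_fun do rewrite mxE.
    exact: Ck_sub UV (h _ _ oV (@subIsetl _ _ _) (sF j) c Sc k).
  apply: Ck_invmx => // a b; under eq_fun do rewrite mxE.
  exact: Ck_sub UV (omega_smooth oV (sF a) (sF b) Sc k).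
apply: (Ck_congr oD _ C) => q Uq; have [cq _] := Uq.
set p := chart_inv c q; have cp : chart_dom c p by exact: chart_invP.
have E : (\row_j chart_coord S c j Z p) *m G q = hh q.
  apply/rowP => j; rewrite !mxE -/p [in RHS](field_frame Z Sc cp).
  rewrite bilinear_suml//; apply: eq_bigr => a _.
  by rewrite bilinearZl// !mxE.
by rewrite -E mulmxK ?Gu// mxE.
Qed.

(** By [smooth_field_omega] it suffices to pair with a smooth W, and this pairing is omega(X, A
    W). *)
Lemma smooth_adjoint U A : open U -> smooth_endo S U A ->
  (forall p (v w : tangent), omega p w v = - omega p v w) ->
  smooth_endo S U (fun p => adjoint (omega p) (A p)).
Proof.
move=> oU sA sk V X oV VU sX; apply: smooth_field_omega => // V' W oV' V'V sW.
have sAW : smooth_field S V' (fun p => A p *m W p).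
  by apply: sA => //; exact: subset_trans VU.
have := omega_smooth oV' (smooth_field_sub V'V sX) sAW.
by apply: smooth_fun_congr => // p _; rewrite adjoint_formr.
Qed.

End Form.

Section Near.
Variable x : M.

Lemma near_fun2 f g : smooth_fun_near S x f -> smooth_fun_near S x g ->
  exists U, [/\ open U, U x, smooth_fun S U f & smooth_fun S U g].
Proof.
move=> [U [oU Ux sf]] [V [oV Vx sg]]; exists (U `&` V); split=> //.
- exact: openI.
- exact: smooth_fun_sub (@subIsetl _ _ _) sf.
- exact: smooth_fun_sub (@subIsetr _ _ _) sg.
Qed.

Lemma near_field2 Y Z : smooth_field_near S x Y -> smooth_field_near S x Z ->
  exists U, [/\ open U, U x, smooth_field S U Y & smooth_field S U Z].
Proof.
move=> [U [oU Ux sf]] [V [oV Vx sg]]; exists (U `&` V); split=> //.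
- exact: openI.
- exact: smooth_field_sub (@subIsetl _ _ _) sf.
- exact: smooth_field_sub (@subIsetr _ _ _) sg.
Qed.

Lemma smooth_fun_nearD f g : smooth_fun_near S x f -> smooth_fun_near S x g ->
  smooth_fun_near S x (fun p => f p + g p).
Proof. by move=> nf /(near_fun2 nf)[U [? ? ? ?]]; exists U; split=> //; exact: smooth_funD. Qed.

Lemma smooth_fun_nearM f g : smooth_fun_near S x f -> smooth_fun_near S x g ->
  smooth_fun_near S x (fun p => f p * g p).
Proof. by move=> nf /(near_fun2 nf)[U [? ? ? ?]]; exists U; split=> //; exact: smooth_funM. Qed.

Lemma smooth_fun_near_cst (k : R) : smooth_fun_near S x (cst k).
Proof. by exists setT; split=> //; [exact: openT|apply: smooth_fun_cst; exact: openT]. Qed.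

Lemma smooth_field_nearD Y Z : smooth_field_near S x Y -> smooth_field_near S x Z ->
  smooth_field_near S x (fun p => Y p + Z p).
Proof. by move=> nf /(near_field2 nf)[U [? ? ? ?]]; exists U; split=> //; exact: smooth_fieldD. Qed.

Lemma smooth_field_nearZ f Y : smooth_fun_near S x f -> smooth_field_near S x Y ->
  smooth_field_near S x (fun p => f p *: Y p).
Proof.
move=> [U [oU Ux sf]] [V [oV Vx sY]]; exists (U `&` V); split=> //; first exact: openI.
apply: smooth_fieldZ; first exact: openI.
- exact: smooth_fun_sub (@subIsetl _ _ _) sf.
- exact: smooth_field_sub (@subIsetr _ _ _) sY.
Qed.

Lemma smooth_field_near_scale (k : R) Y : smooth_field_near S x Y ->
  smooth_field_near S x (fun p => k *: Y p).
Proof. by apply: (smooth_field_nearZ (f := cst k)); exact: smooth_fun_near_cst. Qed.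

Lemma smooth_field_near_sum (I : Type) (r : seq I) (F : I -> M -> tangent) :
  (forall i, smooth_field_near S x (F i)) ->
  smooth_field_near S x (fun p => \sum_(i <- r) F i p).
Proof.
move=> sF; elim: r => [|i r IH].
  exists setT; split=> //; first exact: openT.
  under eq_fun do rewrite big_nil.
  have oT : open [set: M] by exact: openT.
  have h (i : 'I_0) : smooth_field S [set: M] (fun=> 0) by case: i.
  have := @smooth_field_sum _ _ _ S _ 'I_0 [::] (fun _ _ => 0) oT h.
  by under eq_fun do rewrite big_nil.
by under eq_fun do rewrite big_cons; exact: (smooth_field_nearD (sF i) IH).
Qed.

Lemma smooth_field_near_endo U A Y : open U -> U x -> smooth_endo S U A ->
  smooth_field_near S x Y -> smooth_field_near S x (fun p => A p *m Y p).
Proof.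
move=> oU Ux sA [V [oV Vx sY]]; exists (U `&` V); split=> //; first exact: openI.
exact: (sA _ _ (openI oU oV) (@subIsetl _ _ _)
  (smooth_field_sub (@subIsetr _ _ _) sY)).
Qed.

Lemma smooth_field_near_congr U Y Z : open U -> U x ->
  (forall p, U p -> Y p = Z p) -> smooth_field_near S x Y -> smooth_field_near S x Z.
Proof.
move=> oU Ux YZ [V [oV Vx sY]]; exists (U `&` V); split=> //; first exact: openI.
have oUV : open (U `&` V) by exact: openI.
apply: (smooth_field_congr oUV (Y := Y)) => [p [Up _]|]; first exact: YZ.
exact: smooth_field_sub (@subIsetr _ _ _) sY.
Qed.

Lemma smooth_form_near omega Y Z : smooth_form2 S omega ->
  smooth_field_near S x Y -> smooth_field_near S x Z ->
  smooth_fun_near S x (fun p => omega p (Y p) (Z p)).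
Proof. by move=> so nY /(near_field2 nY)[U [? ? ? ?]]; exists U; split=> //; exact: so. Qed.

Lemma smooth_extend v : smooth_field_near S x (extend S x v).
Proof.
apply: (smooth_field_near_congr (U := setT)
  (Y := fun p => \sum_i v i 0 *: frame S (at_ x) i p)) => //; first exact: openT.
  move=> p _; rewrite /extend {2}(col_sum_std v) change_sum.
  by apply: eq_bigr => i _; rewrite change_scale.
apply: smooth_field_near_sum => i; apply: smooth_field_near_scale.
exists (chart_dom (at_ x)); split=> //; first exact: chart_dom_open.
exact: frame_smooth.
Qed.

Lemma extendE v : extend S x v x = v.
Proof. exact: change_id. Qed.

(** A cutoff that replaces bump functions: smoothness is required only near x, where the indicator
    of an open set containing x is constant. *)
Definition indic U p : R := if `[< U p >] then 1 else 0.

Lemma indicT U p : U p -> indic U p = 1.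
Proof. by move=> Up; rewrite /indic asboolT. Qed.

Lemma smooth_indic U : open U -> U x -> smooth_fun_near S x (indic U).
Proof.
move=> oU Ux; exists U; split=> //; have := smooth_fun_cst (S := S) 1 oU.
by apply: smooth_fun_congr => // p Up; rewrite indicT.
Qed.

Lemma dfun_indic U v : open U -> U x -> dfun S (indic U) x v = 0.
Proof.
move=> oU Ux; rewrite -(dfun_cst S 1 x v); apply/esym.
apply: (dfun_congr v oU Ux) => [p Up|]; first by rewrite indicT.
exact: smooth_fun_near_cst.
Qed.

(** Linearity over functions makes F depend on the value at x alone, through the expansion of Y in a
    coordinate frame. *)
Lemma tensorial (W : lmodType R) (F : (M -> tangent) -> W) :
  (forall Y Z, smooth_field_near S x Y -> smooth_field_near S x Z ->
    F (fun p => Y p + Z p) = F Y + F Z) ->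
  (forall f Y, smooth_fun_near S x f -> smooth_field_near S x Y ->
    F (fun p => f p *: Y p) = f x *: F Y) ->
  forall Y, smooth_field_near S x Y ->
    F Y = \sum_i Y x i 0 *: F (extend S x (std R i)).
Proof.
move=> FD FZ Y nY; have [U [oU Ux sY]] := nY.
have oc := @chart_dom_open _ _ _ (at_ x).
pose V := U `&` chart_dom (at_ x).
have oV : open V by exact: openI.
have Vx : V x by split.
have nV := smooth_indic oV Vx.
pose f i p := indic V p * chart_coord S (at_ x) i Y p.
have nf i : smooth_fun_near S x (f i).
  apply: smooth_fun_nearM => //; exists V; split=> //.
  exact: coord_smooth.
(* Multiplied by the indicator of V, the expansion of Y in the chart frame,
   which only makes sense near x, becomes an equality of total functions. *)
transitivity (F (fun p => indic V p *: Y p)).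
  by rewrite FZ// indicT// scale1r.
have -> : (fun p => indic V p *: Y p) =
    (fun p => \sum_i f i p *: extend S x (std R i) p).
  apply/funext => p; rewrite /f /indic; case: asboolP => [[Up xp]|_].
    by rewrite scale1r {1}(field_frame Y (atlas_at S x) xp); apply: eq_bigr => i _; rewrite mul1r.
  by rewrite scale0r big1// => i _; rewrite mul0r scale0r.
have F0 : F (fun=> 0) = 0.
  have nE := smooth_extend (0 : tangent).
  have := FZ (cst 0) _ (smooth_fun_near_cst 0) nE.
  by under [in F _]eq_fun do rewrite scale0r; rewrite scale0r.
have Fs (r : seq 'I_m) : F (fun p => \sum_(i <- r) f i p *: extend S x (std R i) p)
    = \sum_(i <- r) f i x *: F (extend S x (std R i)).
  elim: r => [|i r IH].
    by under [in F _]eq_fun do rewrite big_nil; rewrite big_nil.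
  under [in F _]eq_fun do rewrite big_cons.
  rewrite big_cons FD ?IH ?FZ//.
  - exact: smooth_extend.
  - by apply: smooth_field_nearZ => //; exact: smooth_extend.
  - apply: smooth_field_near_sum => j; apply: smooth_field_nearZ => //.
    exact: smooth_extend.
rewrite Fs; apply: eq_bigr => i _; congr (_ *: _).
by rewrite /f indicT// mul1r /chart_coord change_id.
Qed.

(** What [nabla], [averaged] and [adapted] have in common at one point and in one direction. *)
Definition leibniz v (D : (M -> tangent) -> tangent) : Prop :=
  (forall Y Z, smooth_field_near S x Y -> smooth_field_near S x Z ->
    D (fun p => Y p + Z p) = D Y + D Z) /\
  (forall f Y, smooth_fun_near S x f -> smooth_field_near S x Y ->
    D (fun p => f p *: Y p) = dfun S f x v *: Y x + f x *: D Y).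

Section Leibniz.
Variables (v : tangent) (D : (M -> tangent) -> tangent).
Hypothesis D_leibniz : leibniz v D.

(** Multiplying by the indicator of U turns local equality into equality of total functions, and
    leaves D unchanged since it has value 1 and derivative 0 at x. *)
Lemma leibniz_local U Y Z : open U -> U x -> (forall p, U p -> Y p = Z p) ->
  smooth_field_near S x Y -> D Y = D Z.
Proof.
move=> oU Ux YZ nY; have nZ := smooth_field_near_congr oU Ux YZ nY.
have nU := smooth_indic oU Ux.
have E W : smooth_field_near S x W -> D (fun p => indic U p *: W p) = D W.
  by move=> nW; rewrite D_leibniz.2// dfun_indic// scale0r add0r indicT// scale1r.
rewrite -(E Y)// -(E Z)//; congr D; apply/funext => p; rewrite /indic.
by case: asboolP => [/YZ ->|_]; rewrite ?scale0r.
Qed.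

Lemma leibniz_scale (k : R) Y : smooth_field_near S x Y ->
  D (fun p => k *: Y p) = k *: D Y.
Proof.
move=> nY; rewrite (D_leibniz.2 (cst k))//; last exact: smooth_fun_near_cst.
by rewrite dfun_cst scale0r add0r.
Qed.

End Leibniz.

(** The derivative terms of the two Leibniz rules cancel, so the difference is tensorial. *)
Lemma leibniz_sub v D D' Y : leibniz v D -> leibniz v D' -> smooth_field_near S x Y ->
  D Y - D' Y = \sum_i Y x i 0 *: (D (extend S x (std R i)) - D' (extend S x (std R i))).
Proof.
move=> Dl Dl' nY; apply: (tensorial (F := fun Y => D Y - D' Y)) => // {nY}Y.
  by move=> Z nY nZ; rewrite Dl.1// Dl'.1// opprD addrACA.
by move=> Z nY nZ; rewrite Dl.2// Dl'.2// opprD addrACA subrr add0r scalerBr.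
Qed.

End Near.
End Tensors.

(** * The local connection preserving the basis and the form *)

Section HasDfun.
Variables (R : realType) (m : nat) (M : topologicalType) (S : manifold R m M).
Variables (x : M) (v : 'cV[R]_m).

(** Smoothness and the derivative travel together, so that the derivative of a polynomial expression
    such as Phi can be synthesized along its construction. *)
Definition has_dfun (f : M -> R) (l : R) :=
  smooth_fun_near S x f /\ dfun S f x v = l.

Lemma has_dfunD f g k l : has_dfun f k -> has_dfun g l ->
  has_dfun (fun p => f p + g p) (k + l).
Proof. by move=> [sf <-] [sg <-]; split; [exact: smooth_fun_nearD|exact: dfunD]. Qed.

Lemma has_dfunM f g k l : has_dfun f k -> has_dfun g l ->
  has_dfun (fun p => f p * g p) (f x * l + g x * k).
Proof. by move=> [sf <-] [sg <-]; split; [exact: smooth_fun_nearM|exact: dfunM]. Qed.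

Lemma has_dfun_scale (a : R) f l : has_dfun f l -> has_dfun (fun p => a * f p) (a * l).
Proof.
move=> fl; have := @has_dfunM (cst a) f 0 l _ fl; rewrite /= mulr0 addr0; apply.
by split; [exact: smooth_fun_near_cst|exact: dfun_cst].
Qed.

Lemma has_dfun_sum (I : Type) (r : seq I) (F : I -> M -> R) (l : I -> R) :
  (forall i, has_dfun (F i) (l i)) ->
  has_dfun (fun p => \sum_(i <- r) F i p) (\sum_(i <- r) l i).
Proof.
move=> h; elim: r => [|i r IH].
  rewrite big_nil; under eq_fun do rewrite big_nil.
  by split; [exact: smooth_fun_near_cst|exact: dfun_cst].
by rewrite big_cons; under eq_fun do rewrite big_cons; exact: (has_dfunD (h i) IH).
Qed.

End HasDfun.

Section AdaptedConnection.
Variables (R : realType) (m : nat) (M : topologicalType) (S : manifold R m M)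
  (Q : M -> set 'M[R]_m) (omega : M -> 'cV[R]_m -> 'cV[R]_m -> R)
  (hQ : almost_quaternionic_skew_hermitian S Q omega)
  (nabla : M -> 'cV[R]_m -> (M -> 'cV[R]_m) -> 'cV[R]_m)
  (hnabla : affine_connection S nabla).
Local Notation tangent := 'cV[R]_m.

Variables (U0 : set M) (U0_open : open U0) (J : 'I_3 -> M -> 'M[R]_m)
  (J_smooth : forall a, smooth_endo S U0 (J a))
  (J_basis : forall p, U0 p -> admissible_basis (Q p) (J^~ p)).

Implicit Types (U V : set M) (f : M -> R) (X Y Z : M -> tangent) (p : M) (v w : tangent).

Let omega_bilinear p : bilinear_form (omega p).
Proof. exact: aqsh_bilinear hQ p. Qed.
Let omega_nondegenerate p : Defs.nondegenerate (omega p).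
Proof. exact: aqsh_nondegenerate hQ p. Qed.
Let omega_skew p v w : omega p w v = - omega p v w.
Proof. exact: aqsh_skew hQ p v w. Qed.
Let omega_smooth : smooth_form2 S omega.
Proof. exact: aqsh_smooth hQ. Qed.
Let oE p := bilinearE (omega_bilinear p).

Let J_triple p : U0 p -> admissible_triple (J^~ p).
Proof. by case/J_basis. Qed.
Let J_omega p : U0 p -> forall a v w, omega p (J a p *m v) (J a p *m w) = omega p v w.
Proof. by move=> /J_basis Jp a v w; exact: (aqsh_invariant hQ Jp). Qed.
Let J_skew p a v w : U0 p -> omega p (J a p *m v) w = - omega p v (J a p *m w).
Proof.
move=> Up; rewrite -(J_omega Up a v) mulmxA (JJ (J_triple Up)) mulNmx mul1mx.
by rewrite oE opprK.
Qed.

Let smooth_J p a Y : U0 p -> smooth_field_near S p Y ->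
  smooth_field_near S p (fun q => J a q *m Y q).
Proof. by move=> Up nY; exact: (smooth_field_near_endo U0_open Up (J_smooth a) nY). Qed.

Let smooth_omega p Y Z : smooth_field_near S p Y -> smooth_field_near S p Z ->
  smooth_fun_near S p (fun q => omega q (Y q) (Z q)).
Proof. exact: smooth_form_near. Qed.

Lemma nabla_leibniz p v : leibniz S p v (nabla p v).
Proof.
split=> [Y Z nY nZ|f Y nf nY]; first exact: (connection_add hnabla).
exact: (connection_leibniz hnabla).
Qed.

(* The average of the conjugates of nabla by 1, J_1, J_2 and J_3: a connection
   commuting with the J_a. *)
Definition averaged p v Y : tangent := locked (4^-1 *: (nabla p v Y
  - \sum_(a < 3) J a p *m nabla p v (fun q => J a q *m Y q))).

Lemma averaged_leibniz p v : U0 p -> leibniz S p v (averaged p v).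
Proof.
move=> Up; have nl := nabla_leibniz p v; split=> [Y Z nY nZ|f Y nf nY].
  have E a : (fun q => J a q *m (Y q + Z q)) =
      (fun q => J a q *m Y q + J a q *m Z q).
    by apply/funext => q; rewrite mulmxDr.
  rewrite /averaged -!lock nl.1// -scalerDr; congr (_ *: _).
  rewrite addrACA -opprD -big_split/=; congr (_ - _); apply: eq_bigr => a _.
  by rewrite E nl.1 ?mulmxDr//; exact: smooth_J.
have E a : (fun q => J a q *m (f q *: Y q)) = (fun q => f q *: (J a q *m Y q)).
  by apply/funext => q; rewrite scalemxAr.
(* As J_a J_a = -1, each conjugate contributes df(v) Y once more; the four copies are compensated by
   1/4. *)
have EJ a : J a p *m nabla p v (fun q => J a q *m (f q *: Y q)) =
    - (dfun S f p v *: Y p) + f p *: (J a p *m nabla p v (fun q => J a q *m Y q)).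
  rewrite E nl.2//; last exact: smooth_J.
  rewrite mulmxDr -!scalemxAr mulmxA (JJ (J_triple Up)) mulNmx mul1mx scalerN.
  by [].
rewrite /averaged -!lock nl.2// !sum3 !EJ.
move: (J 0 p *m _) (J 1 p *m _) (J 2 p *m _) (nabla _ _ _) (Y p) => a b c d e.
by apply/matrixP => i j; rewrite !mxE; field.
Qed.

(** Passing from Y to J_b Y permutes the four conjugates, up to J_b on the left. The relations J_a
    J_b = J_c hold only on [U0], so locality of nabla enters. *)
Lemma averaged_J p v b Y : U0 p -> smooth_field_near S p Y ->
  averaged p v (fun q => J b q *m Y q) = J b p *m averaged p v Y.
Proof.
move=> Up nY; have nl := nabla_leibniz p v.
have nJY a : smooth_field_near S p (fun q => J a q *m Y q) by exact: smooth_J.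
have DJJ (a b1 : 'I_3) k (C : M -> 'M[R]_m) :
    (forall q, U0 q -> J a q *m J b1 q = k *: C q) ->
    smooth_field_near S p (fun q => C q *m Y q) ->
    nabla p v (fun q => J a q *m (J b1 q *m Y q)) = k *: nabla p v (fun q => C q *m Y q).
  move=> JC nC; rewrite -(leibniz_scale nl)//; apply: (leibniz_local nl U0_open Up).
    by move=> q Uq; rewrite mulmxA JC// scalemxAl.
  exact/smooth_J/nJY.
have D1 (a : 'I_3) : nabla p v (fun q => J a q *m (J a q *m Y q)) = - nabla p v Y.
  have E1 : (fun q => 1%:M *m Y q) = Y by apply/funext => q; rewrite mul1mx.
  rewrite (DJJ a a (-1) (fun=> 1%:M)) ?E1 ?scaleN1r// => q Uq.
  by rewrite (JJ (J_triple Uq)) ?scaleN1r.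
have DN (a b1 c : 'I_3) : (forall q, U0 q -> J a q *m J b1 q = - J c q) ->
    nabla p v (fun q => J a q *m (J b1 q *m Y q)) = - nabla p v (fun q => J c q *m Y q).
  move=> h; rewrite (DJJ a b1 (-1) (J c)) ?scaleN1r// => q Uq.
  by rewrite h// ?scaleN1r.
have DP (a b1 c : 'I_3) : (forall q, U0 q -> J a q *m J b1 q = J c q) ->
    nabla p v (fun q => J a q *m (J b1 q *m Y q)) = nabla p v (fun q => J c q *m Y q).
  move=> h; rewrite (DJJ a b1 1 (J c)) ?scale1r// => q Uq.
  by rewrite h// ?scale1r.
have P01 := DP 0 1 2 (fun q Uq => J01 (J_triple Uq)).
have P12 := DP 1 2 0 (fun q Uq => J12 (J_triple Uq)).
have P20 := DP 2 0 1 (fun q Uq => J20 (J_triple Uq)).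
have P10 := DN 1 0 2 (fun q Uq => J10 (J_triple Uq)).
have P21 := DN 2 1 0 (fun q Uq => J21 (J_triple Uq)).
have P02 := DN 0 2 1 (fun q Uq => J02 (J_triple Uq)).
have JEp := JE (J_triple Up).
rewrite /averaged -!lock !sum3 -scalemxAr; congr (_ *: _).
rewrite mulmxBr !mulmxDr !mulmxA.
by move: b; apply: forall3; rewrite !D1 ?P01 ?P12 ?P20 ?P10 ?P21 ?P02 !JEp;
  rewrite !(mulmxN, mulNmx, mul1mx);
  move: (nabla p v _) (nabla p v _) (nabla p v _) (nabla p v _) => d0 d1 d2 d3;
  apply/matrixP => i j; rewrite !mxE; ring.
Qed.

Definition koszul p v Y Z : R := 2^-1 * (omega p (averaged p v Y) (Z p)
  + dfun S (fun q => omega q (Y q) (Z q)) p v - omega p (Y p) (averaged p v Z)).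

(* The vector representing koszul Y: the half-sum of averaged and of its dual
   connection with respect to omega. *)
Definition adapted p v Y : tangent :=
  locked ((\row_j koszul p v Y (extend S p (std R j))) *m invmx (gram (omega p)))^T.

(** [adapted] is defined by pairing with coordinate fields only. In Z the derivative terms of
    [koszul] cancel, so it is tensorial there and the identity extends to every Z. *)
Lemma adaptedP p v Y Z : U0 p -> smooth_field_near S p Y -> smooth_field_near S p Z ->
  omega p (adapted p v Y) (Z p) = koszul p v Y Z.
Proof.
move=> Up nY nZ; have al := averaged_leibniz v Up.
rewrite (tensorial (F := koszul p v Y : _ -> R^o) _ _ nZ); first last.
- move=> f {nZ}Z nf nZ; rewrite /koszul al.2//.
  have -> : (fun q => omega q (Y q) (f q *: Z q)) = (fun q => f q * omega q (Y q) (Z q)).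
    by apply/funext => q; rewrite oE.
  rewrite dfunM//; last exact: smooth_omega.
  rewrite !oE /GRing.scale/=.
  move: (averaged p v Y) (averaged p v Z) (dfun S f p v) (dfun S _ p v) => D D' d d'.
  by ring.
- move=> {nZ}Z Z' nZ nZ'; rewrite /koszul al.1//.
  have -> : (fun q => omega q (Y q) (Z q + Z' q))
      = (fun q => omega q (Y q) (Z q) + omega q (Y q) (Z' q)).
    by apply/funext => q; rewrite oE.
  rewrite dfunD; [|exact: smooth_omega|exact: smooth_omega].
  rewrite !oE.
  move: (averaged p v Y) (averaged p v Z) (averaged p v Z') => D D1 D2.
  move: (dfun S _ p v) (dfun S _ p v) => d1 d2.
  by ring.
rewrite bilinear_gram// /adapted -lock trmxK mulmxKV ?gram_unit// mxE.
by apply: eq_bigr => j _; rewrite mxE mulrC.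
Qed.

Let omega_extend p v w : (forall Z, smooth_field_near S p Z ->
  omega p v (Z p) = omega p w (Z p)) -> v = w.
Proof.
move=> h; apply: (omega_inj (omega_bilinear p) (@omega_nondegenerate p)) => z.
by rewrite -(extendE S p z); apply: h; exact: smooth_extend.
Qed.

(** In Y, unlike in Z, the term df(v) omega(Y, Z) appears twice, from [averaged] and from the
    derivative of omega(Y, Z), which the factor 1/2 compensates. *)
Lemma adapted_leibniz p v : U0 p -> leibniz S p v (adapted p v).
Proof.
move=> Up; have al := averaged_leibniz v Up; split=> [Y Y' nY nY'|f Y nf nY].
  have nYY' := smooth_field_nearD nY nY'.
  apply: (omega_extend (p := p)) => Z nZ; rewrite oE !adaptedP// /koszul al.1//.
  have -> : (fun q => omega q (Y q + Y' q) (Z q))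
      = (fun q => omega q (Y q) (Z q) + omega q (Y' q) (Z q)).
    by apply/funext => q; rewrite oE.
  rewrite dfunD; [|exact: smooth_omega|exact: smooth_omega].
  rewrite !oE.
  move: (averaged p v Y) (averaged p v Y') (averaged p v Z) => D1 D2 D.
  move: (dfun S _ p v) (dfun S _ p v) => d1 d2.
  by ring.
have nfY := smooth_field_nearZ nf nY.
apply: (omega_extend (p := p)) => Z nZ; rewrite !oE !adaptedP// /koszul al.2//.
have -> : (fun q => omega q (f q *: Y q) (Z q)) = (fun q => f q * omega q (Y q) (Z q)).
  by apply/funext => q; rewrite oE.
rewrite dfunM//; last exact: smooth_omega.
rewrite !oE.
move: (averaged p v Y) (averaged p v Z) (dfun S f p v) (dfun S _ p v) => D D' d d'.
by field.
Qed.

(** The right-hand side is koszul(Y, Z) - koszul(Z, Y): by skewness of omega the averaged terms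
    cancel and the two halves of the derivative add up. *)
Lemma adapted_omega p v Y Z : U0 p -> smooth_field_near S p Y -> smooth_field_near S p Z ->
  dfun S (fun q => omega q (Y q) (Z q)) p v
  = omega p (adapted p v Y) (Z p) + omega p (Y p) (adapted p v Z).
Proof.
move=> Up nY nZ; rewrite [omega p (Y p) _]omega_skew !adaptedP// /koszul.
rewrite (omega_skew p (Y p) (averaged p v Z)) (omega_skew p (averaged p v Y) (Z p)).
have -> : (fun q => omega q (Z q) (Y q)) = (fun q => -1 * omega q (Y q) (Z q)).
  by apply/funext => q; rewrite mulN1r.
have [_ ->] := has_dfun_scale (-1) (conj (smooth_omega nY nZ) (erefl (dfun S _ p v))).
move: (averaged p v Y) (averaged p v Z) (dfun S _ p v) => D D' d.
by field.
Qed.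

(** J_b is moved onto the test field Z by skewness, also under the derivative, where this holds
    throughout [U0]; [averaged] already commutes with it. *)
Lemma adapted_J p v b Y : U0 p -> smooth_field_near S p Y ->
  adapted p v (fun q => J b q *m Y q) = J b p *m adapted p v Y.
Proof.
move=> Up nY; have nJY := smooth_J b Up nY.
apply: (omega_extend (p := p)) => Z nZ; have nJZ := smooth_J b Up nZ.
have /= E := adaptedP v Up nY nJZ.
rewrite J_skew// E adaptedP// /koszul !averaged_J// !J_skew//.
rewrite (_ : dfun S (fun q => omega q (J b q *m Y q) (Z q)) p v
  = - dfun S (fun q => omega q (Y q) (J b q *m Z q)) p v); last first.
  rewrite -mulN1r; have [_ <-] := has_dfun_scale (-1)
    (conj (smooth_omega nY nJZ) (erefl (dfun S _ p v))).
  apply: (dfun_congr v U0_open Up) => [q Uq|]; last exact: smooth_omega.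
  by rewrite J_skew// mulN1r.
move: (averaged p v Y) (averaged p v Z) (dfun S _ p v) => D D' d.
by ring.
Qed.

Lemma adapted_linear p Y : U0 p -> smooth_field_near S p Y ->
  linear (fun v => adapted p v Y).
Proof.
move=> Up nY k v w; apply: (omega_extend (p := p)) => Z nZ.
have al Z' : smooth_field_near S p Z' ->
    averaged p (k *: v + w) Z' = k *: averaged p v Z' + averaged p w Z'.
  move=> nZ'; have nl W : smooth_field_near S p W ->
      nabla p (k *: v + w) W = k *: nabla p v W + nabla p w W.
    by move=> nW; rewrite (connection_linear hnabla).
  rewrite /averaged -!lock !sum3 !nl//; try exact: smooth_J.
  rewrite !mulmxDr -!scalemxAr.
  by apply/matrixP => i j; rewrite !mxE; ring.
rewrite !oE !adaptedP// /koszul !al//.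
have -> := dfun_linear S (fun q => omega q (Y q) (Z q)) p k v w.
rewrite !oE /GRing.scale/=.
move: (averaged p v Y) (averaged p w Y) (averaged p v Z) (averaged p w Z).
move: (dfun S _ p v) (dfun S _ p w) => d d' D1 D2 D3 D4.
by ring.
Qed.

Definition difference p v : 'M[R]_m := locked (\matrix_(i, j)
  (nabla p v (extend S p (std R j)) - adapted p v (extend S p (std R j))) i 0).

Lemma differenceE p v i j : difference p v i j =
  (nabla p v (extend S p (std R j)) - adapted p v (extend S p (std R j))) i 0.
Proof. by rewrite /difference -lock mxE. Qed.

Lemma differenceP p v Y : U0 p -> smooth_field_near S p Y ->
  nabla p v Y = adapted p v Y + difference p v *m Y p.
Proof.
move=> Up nY; apply/eqP; rewrite addrC -subr_eq; apply/eqP.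
rewrite (leibniz_sub (nabla_leibniz p v) (adapted_leibniz v Up) nY).
apply/colP => i; rewrite summxE [RHS]mxE; apply: eq_bigr => j _.
by rewrite [LHS]mxE differenceE mulrC.
Qed.

Lemma difference_linear p : U0 p -> linear (difference p).
Proof.
move=> Up k v w; apply/matrixP => i j.
have nE := smooth_extend S p (std R j).
have mxlin (A B : 'M[R]_m) : (k *: A + B) i j = k * A i j + B i j by rewrite !mxE.
apply: (etrans (differenceE _ _ _ _)).
rewrite (connection_linear hnabla)// (adapted_linear Up)// mxlin !differenceE.
move: (nabla p v _) (nabla p w _) (adapted p v _) (adapted p w _) => a b c d.
by rewrite !mxE; ring.
Qed.

(** Near p, Phi may be written with the smooth basis J, and D preserves omega and J, hence Phi; only
    the tensor nabla - D is left to act. *)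
Lemma cov_deriv4_Phi (Jx : M -> 'I_3 -> 'M[R]_m) p : (0 < m)%N ->
  (forall q, admissible_basis (Q q) (Jx q)) -> U0 p ->
  cov_deriv4 S nabla (fun q => Phi (omega q) (Jx q)) p
  = p_map (omega p) (J^~ p) (difference p).
Proof.
move=> m0 hJ Up.
have PhiE q : U0 q -> Phi (omega q) (Jx q) = Phi (omega q) (J^~ q).
  move=> Uq; have [t s] := hJ q; have [t' s'] := J_basis Uq.
  by apply: Phi_basis => //; rewrite -s s'.
apply/funext => v; apply/funext => y; apply/funext => z; apply/funext => u.
apply/funext => w; rewrite /cov_deriv4 /p_map /action.
have ne := smooth_extend S p.
have hg a y1 z1 : has_dfun S p v
    (fun q => gJ (omega q) (J a q) (extend S p y1 q) (extend S p z1 q))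
    (gJ (omega p) (J a p) (adapted p v (extend S p y1)) z1
     + gJ (omega p) (J a p) y1 (adapted p v (extend S p z1))).
  have nJ : smooth_field_near S p (fun q => J a q *m extend S p z1 q).
    exact: smooth_J.
  split; first exact: smooth_omega.
  by rewrite [LHS]adapted_omega// adapted_J// !extendE.
have hPhi : exists l, has_dfun S p v (fun q => Phi (omega q) (J^~ q)
    (extend S p y q) (extend S p z q) (extend S p u q) (extend S p w q)) l /\ 
  l = Phi (omega p) (J^~ p) (adapted p v (extend S p y)) z u w
    + Phi (omega p) (J^~ p) y (adapted p v (extend S p z)) u w
    + Phi (omega p) (J^~ p) y z (adapted p v (extend S p u)) w
    + Phi (omega p) (J^~ p) y z u (adapted p v (extend S p w)).
  (* The value l is left open for the Leibniz rules to produce, and is identified by [ring]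
     afterwards. *)
  eexists; split.
    apply: has_dfun_sum => a; rewrite /symprod; apply: has_dfun_scale.
    by repeat apply: has_dfunD; apply: has_dfunM; exact: hg.
  rewrite /= !extendE /Phi -!big_split; apply: eq_bigr => a _ /=.
  by rewrite /symprod; ring.
have [l [[sPhi dPhi] lE]] := hPhi.
have dE : dfun S (fun q => Phi (omega q) (Jx q)
    (extend S p y q) (extend S p z q) (extend S p u q) (extend S p w q)) p v = l.
  rewrite -dPhi; apply/esym; apply: (dfun_congr v U0_open Up) => // q Uq.
  by rewrite PhiE.
rewrite {}dE {}lE (PhiE _ Up) !differenceP// !extendE.
rewrite /Phi !sum3 /symprod /gJ !mulmxDr !oE.
by ring.
Qed.

Section Smooth.
Variables (U : set M) (U_open : open U) (UU0 : U `<=` U0).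

Lemma averaged_smooth X Y : smooth_field S U X -> smooth_field S U Y ->
  smooth_field S U (fun p => averaged p (X p) Y).
Proof.
move=> sX sY.
have sJ a Z : smooth_field S U Z -> smooth_field S U (fun q => J a q *m Z q).
  by move=> sZ; exact: (@J_smooth a U Z U_open UU0 sZ).
have s := smooth_field_scale 4^-1 U_open (smooth_fieldB U_open
  (connection_smooth hnabla U_open sX sY)
  (smooth_field_sum (index_enum 'I_3) U_open
    (fun a => sJ a _ (connection_smooth hnabla U_open sX (sJ a _ sY))))).
by apply: (smooth_field_congr U_open _ s) => p _; rewrite /averaged -lock.
Qed.

Lemma koszul_smooth X Y Z : smooth_field S U X -> smooth_field S U Y ->
  smooth_field S U Z -> smooth_fun S U (fun p => koszul p (X p) Y Z).
Proof.
move=> sX sY sZ; apply: (smooth_fun_scale _ U_open).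
apply: (smooth_funB U_open); last first.
  exact: (omega_smooth U_open sY (averaged_smooth sX sZ)).
apply: (smooth_funD U_open); first exact: (omega_smooth U_open (averaged_smooth sX sY) sZ).
exact: (dfun_smooth U_open (omega_smooth U_open sY sZ) sX).
Qed.

End Smooth.

Lemma adapted_smooth U X Y : open U -> U `<=` U0 ->
  smooth_field S U X -> smooth_field S U Y ->
  smooth_field S U (fun p => adapted p (X p) Y).
Proof.
move=> oU UU0 sX sY; apply: (smooth_field_omega omega_smooth) => // V W oV VU sW.
have sYV := smooth_field_sub VU sY.
have s := koszul_smooth oV (subset_trans VU UU0) (smooth_field_sub VU sX) sYV sW.
apply: (smooth_fun_congr oV _ s) => p Vp; rewrite adaptedP//; last 2 first.
- by exists V.
- by exists V.
- exact/UU0/VU.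
Qed.

Lemma difference_smooth U X : open U -> U `<=` U0 -> smooth_field S U X ->
  smooth_endo S U (fun p => difference p (X p)).
Proof.
move=> oU UU0 sX V Y oV VU sY; have sXV := smooth_field_sub VU sX.
have s := smooth_fieldB oV (connection_smooth hnabla oV sXV sY)
  (adapted_smooth oV (subset_trans VU UU0) sXV sY).
apply: (smooth_field_congr oV _ s) => p Vp.
rewrite differenceP; [|exact/UU0/VU|by exists V].
by rewrite addrC addKr.
Qed.

Lemma stabilizer_part_smooth U (B : M -> 'M[R]_m) : open U -> U `<=` U0 ->
  smooth_endo S U B ->
  smooth_endo S U (fun p => stabilizer_part (omega p) (J^~ p) (B p)).
Proof.
move=> oU UU0 sB; have sJ a := smooth_endo_sub UU0 (J_smooth a).
have sp : smooth_endo S U (fun p => pi11 (J^~ p) (B p)).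
  apply: smooth_endo_scale; apply: (smooth_endoB sB); apply: smooth_endo_sum => a.
  exact: (smooth_endoM (smooth_endoM (sJ a) sB) (sJ a)).
under eq_fun do rewrite stabilizer_partE//.
have sad := smooth_adjoint omega_smooth omega_bilinear omega_nondegenerate oU sp omega_skew.
have st a : smooth_endo S U (fun p => \tr (B p *m J a p) *: J a p).
  exact: (smooth_endoZ (smooth_trace oU (smooth_endoM sB (sJ a))) (sJ a)).
exact: (smooth_endoB (smooth_endo_scale 2^-1 (smooth_endoB sp sad))
  (smooth_endo_scale m%:R^-1 (smooth_endo_sum (index_enum 'I_3) st))).
Qed.

Lemma form2_adapted_add p v Y Z B : U0 p ->
  smooth_field_near S p Y -> smooth_field_near S p Z -> adjoint (omega p) B = - B ->
  dfun S (fun q => omega q (Y q) (Z q)) p v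
  = omega p (adapted p v Y + B *m Y p) (Z p) + omega p (Y p) (adapted p v Z + B *m Z p).
Proof.
move=> Up nY nZ BE; rewrite adapted_omega// !oE addrACA -[LHS]addr0; congr (_ + _).
by rewrite (adjointP (omega_bilinear p) (@omega_nondegenerate p)) BE mulNmx oE addNr.
Qed.

Lemma span3_lin (J3 : 'I_3 -> 'M[R]_m) (c : 'I_3 -> R) (F : 'I_3 -> 'M[R]_m) :
  (forall a, span3 J3 (F a)) -> span3 J3 (\sum_a c a *: F a).
Proof.
move=> /choice[d dE]; exists (fun b => \sum_a c a * d a b).
under [RHS]eq_bigr do rewrite scaler_suml.
rewrite exchange_big; apply: eq_bigr => a _ /=.
by rewrite dE scaler_sumr; apply: eq_bigr => b _; rewrite scalerA.
Qed.

Lemma span3_mem (J3 : 'I_3 -> 'M[R]_m) (k : R) a : span3 J3 (k *: J3 a).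
Proof.
exists (fun b => k * (b == a)%:R); rewrite (bigD1 a)//= eqxx mulr1 big1 ?addr0//.
by move=> b /negbTE ->; rewrite mulr0 scale0r.
Qed.

Lemma span3_comm (J3 : 'I_3 -> 'M[R]_m) a b : admissible_triple J3 ->
  span3 J3 (J3 a *m J3 b - J3 b *m J3 a).
Proof.
move=> t; have s k c : J3 a *m J3 b - J3 b *m J3 a = k *: J3 c ->
  span3 J3 (J3 a *m J3 b - J3 b *m J3 a) by move=> ->; exact: span3_mem.
(* The commutators are 0 or 2 J_c up to sign; each alternative supplies the multiple and the
   index. *)
move: a b s; apply: forall3; apply: forall3; rewrite !(JE t) ?opprK ?addNr => s;
  first [ by apply: (s 0 0); rewrite scale0r
        | by apply: (s 2 0); rewrite scaler_nat
        | by apply: (s 2 1); rewrite scaler_nat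
        | by apply: (s 2 2); rewrite scaler_nat
        | by apply: (s (-2) 0); rewrite scaleNr scaler_nat mulr2n opprD
        | by apply: (s (-2) 1); rewrite scaleNr scaler_nat mulr2n opprD
        | by apply: (s (-2) 2); rewrite scaleNr scaler_nat mulr2n opprD ].
Qed.

(** With A = sum_a f_a J_a near p and D commuting with the J_a, the derivative of A is sum_a df_a(v)
    J_a. Adding B to D adds the commutator of B with A, which stays in the span. *)
Lemma endo_bundle_adapted U (A : M -> 'M[R]_m) p v B : (0 < m)%N -> open U ->
  smooth_endo S U A -> (forall q, U q -> Q q (A q)) -> U p -> U0 p ->
  (forall b, span3 (J^~ p) (B *m J b p - J b p *m B)) ->
  exists2 q, Q p q & forall Y, smooth_field_near S p Y ->
    (adapted p v (fun q => A q *m Y q) + B *m (A p *m Y p))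
    - A p *m (adapted p v Y + B *m Y p) = q *m Y p.
Proof.
move=> m0 oU sA QA Up U0p BJ.
pose V := U `&` U0; have oV : open V by exact: openI.
have Vp : V p by split.
have m0' : m%:R != 0 :> R by rewrite pnatr_eq0 -lt0n.
(* Membership in Q yields coefficients only point by point; since tr(J_a J_b) = - m delta_ab, traces
   exhibit them as smooth functions. *)
pose f (a : 'I_3) q := - m%:R^-1 * \tr (A q *m J a q).
have fE q : V q -> A q = \sum_a f a q *: J a q.
  move=> [Uq U0q]; have [t Qq] := J_basis U0q.
  have := QA q Uq; rewrite Qq => -[c Aq]; rewrite Aq; apply: eq_bigr => a _.
  congr (_ *: _); rewrite /f Aq mulmx_suml linear_sum (bigD1 a)//= big1 => [|b ba].
    by rewrite addr0 -scalemxAl mxtraceZ (mxtraceJJ t) eqxx mulr1n; field.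
  by rewrite -scalemxAl mxtraceZ (mxtraceJJ t) (negbTE ba) mulr0.
have nf a : smooth_fun_near S p (f a).
  exists V; split=> //; apply: (smooth_fun_scale _ oV); apply: smooth_trace => //.
  apply: smooth_endoM; first exact: smooth_endo_sub (@subIsetl _ _ _) sA.
  exact: smooth_endo_sub (@subIsetr _ _ _) (J_smooth a).
have al := adapted_leibniz v U0p.
exists (\sum_a dfun S (f a) p v *: J a p + (B *m A p - A p *m B)).
  have [t ->] := J_basis U0p; rewrite (fE p Vp) mulmx_sumr mulmx_suml -sumrB -big_split/=.
  have -> : \sum_a (dfun S (f a) p v *: J a p + (B *m (f a p *: J a p)
      - f a p *: J a p *m B)) = \sum_a 1 *: (dfun S (f a) p v *: J a p
      + f a p *: (B *m J a p - J a p *m B)).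
    by apply: eq_bigr => a _; rewrite scale1r -scalemxAr -scalemxAl -scalerBr.
  apply: span3_lin => a; have [d dE] := BJ a.
  exists (fun b => dfun S (f a) p v * (b == a)%:R + f a p * d b).
  rewrite dE; under [RHS]eq_bigr do rewrite scalerDl.
  rewrite big_split/=; congr (_ + _).
    by rewrite (bigD1 a)//= eqxx mulr1 big1 ?addr0// => b /negbTE ->; rewrite mulr0 scale0r.
  by rewrite scaler_sumr; apply: eq_bigr => b _; rewrite scalerA.
move=> Y nY; have nJY a : smooth_field_near S p (fun q => J a q *m Y q).
  exact: smooth_J.
have -> : adapted p v (fun q => A q *m Y q) =
    \sum_a (dfun S (f a) p v *: (J a p *m Y p) + f a p *: (J a p *m adapted p v Y)).
  have nfJ a : smooth_field_near S p (fun q => f a q *: (J a q *m Y q)).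
    exact: (smooth_field_nearZ (nf a) (nJY a)).
  have E : adapted p v (fun q => A q *m Y q) =
      adapted p v (fun q => f 0 q *: (J 0 q *m Y q) + f 1 q *: (J 1 q *m Y q)
        + f 2 q *: (J 2 q *m Y q)).
    apply: (leibniz_local al oV Vp) => [q Vq|].
      by rewrite (fE q Vq) sum3 !mulmxDl -!scalemxAl.
    exact: (smooth_field_near_endo oU Up sA nY).
  have nfJ01 := smooth_field_nearD (nfJ 0) (nfJ 1).
  by rewrite E al.1// al.1// !al.2// sum3 !adapted_J.
rewrite big_split/= !mulmxDl mulmxDr mulmx_suml mulNmx !mulmxA.
have -> : \sum_a f a p *: (J a p *m adapted p v Y) = A p *m adapted p v Y.
  by rewrite (fE p Vp) mulmx_suml; apply: eq_bigr => a _; rewrite scalemxAl.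
under [in RHS]eq_bigr do rewrite -scalemxAl.
move: (\sum_a _) (A p *m _) (B *m _ *m _) (A p *m B *m _) => a b c d.
by apply/matrixP => i j; rewrite !mxE; ring.
Qed.

End AdaptedConnection.

Section StabilizerLinear.
Variables (R : realType) (m : nat) (omega : 'cV[R]_m -> 'cV[R]_m -> R)
  (J : 'I_3 -> 'M[R]_m).
Hypotheses (omega_bilinear : bilinear_form omega)
  (omega_nondegenerate : Defs.nondegenerate omega)
  (omega_skew : forall X Y, omega Y X = - omega X Y).

Lemma stabilizer_part_linear : linear (stabilizer_part omega J).
Proof.
move=> k A B; rewrite !stabilizer_partE// !pi11E.
rewrite !(adjointZ, adjointD, adjointN, conjJD, conjJZ).
have -> : traceJ J (k *: A + B) = k *: traceJ J A + traceJ J B.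
  rewrite /traceJ scaler_sumr -big_split; apply: eq_bigr => a _ /=.
  by rewrite mulmxDl -scalemxAl mxtraceD mxtraceZ scalerDl scalerA.
by apply/matrixP => i j; rewrite !mxE; ring.
Qed.

End StabilizerLinear.

(* J picks, at each point separately, an arbitrary admissible basis of Q; it is
   used to write down Phi, the w_i and c, none of which depends on it. *)
Theorem theorem2p15 (R : realType) (n : nat) (hn : (1 < n)%N)
    (M : topologicalType) (S : manifold R (4 * n) M)
    (Q : M -> set 'M[R]_(4 * n))
    (omega : M -> 'cV[R]_(4 * n) -> 'cV[R]_(4 * n) -> R)
    (hQomega : almost_quaternionic_skew_hermitian S Q omega)
    (J : M -> 'I_3 -> 'M[R]_(4 * n))
    (hJ : forall x, admissible_basis (Q x) (J x))
    (nabla : M -> 'cV[R]_(4 * n) -> (M -> 'cV[R]_(4 * n)) -> 'cV[R]_(4 * n))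
    (hnabla : affine_connection S nabla) :
  let Phi_M := fun x => Phi (omega x) (J x) in
  let nabla' := fun x v Y =>
    nabla x v Y
    + correction (omega x) (J x) (cov_deriv4 S nabla Phi_M x) v *m Y x in
  (forall x T, E_fiber (omega x) (J x) T ->
     W1234 (omega x) (J x) (s_map (omega x) (J x) T) /\
     p_map (omega x) (J x) (s_map (omega x) (J x) T) = T) /\
  [/\ affine_connection S nabla', preserves_endo_bundle S nabla' Q
    & preserves_form2 S nabla' omega].
Proof.
move=> Phi_M nabla'.
have n0 : (0 < 4 * n)%N by rewrite muln_gt0 (ltnW hn).
have ob x := aqsh_bilinear hQomega x.
have ond x := aqsh_nondegenerate hQomega x.
have osk x X Y := aqsh_skew hQomega x X Y.
have Jt x : admissible_triple (J x) by case: (hJ x).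
have Jo x := aqsh_invariant hQomega (hJ x).
split.
  move=> x T [A Al ->]; split; first exact: (s_map_W1234 (ob x) (ond x) (osk x) (Jt x) (Jo x) Al).
  by rewrite (p_map_s_map hn (ob x) (ond x) (osk x) (Jt x) (Jo x)).
(* [correction] is formed with the given basis [J p], [adapted] with the smooth [J0]; the
   independence of Phi and A_0 of the basis reconciles them. *)
have corrected (U0 : set M) (J0 : 'I_3 -> M -> 'M[R]_(4 * n)) : open U0 ->
    (forall a, smooth_endo S U0 (J0 a)) ->
    (forall p, U0 p -> admissible_basis (Q p) (J0^~ p)) ->
    forall p v Y, U0 p -> smooth_field_near S p Y ->
    nabla' p v Y = adapted S omega nabla J0 p v Y
      + stabilizer_part (omega p) (J0^~ p) (difference S omega nabla J0 p v) *m Y p.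
  move=> oU sJ hb p v Y Up nY; rewrite /nabla' /Phi_M.
  rewrite (cov_deriv4_Phi hQomega hnabla oU sJ hb n0 hJ Up).
  have [J0t J0Q] := hb p Up; have [_ JQ] := hJ p.
  have JJ0 : span3 (J0^~ p) = span3 (J p) by rewrite -J0Q -JQ.
  rewrite /p_map (Phi_basis n0 (Jt p) J0t JJ0 (ob p)) -/(p_map _ _ _).
  rewrite (correction_p_map hn (ob p) (ond p) (osk p) (Jt p) (Jo p)).
  rewrite (stabilizer_part_basis n0 (Jt p) J0t JJ0).
  rewrite (differenceP hQomega hnabla oU sJ hb v Up nY).
  by rewrite mulmxBl -addrA; congr (_ + _); rewrite addrC subrK.
have local p := aqsh_quaternionic hQomega p.
split.
- split.
  (* Linearity in v and smoothness are read off the local formula D + A_0; additivity and the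
     Leibniz rule persist when an endomorphism applied to Y is added to nabla. *)
  + move=> x Y nY; have [U0 [J0 [oU Ux sJ hb]]] := local x.
    have C := corrected U0 J0 oU sJ hb x _ Y Ux nY.
    move=> k v w; rewrite !C (adapted_linear hQomega hnabla oU sJ hb Ux nY).
    rewrite (difference_linear hQomega hnabla oU sJ hb Ux).
    rewrite (stabilizer_part_linear _ (ob x) (ond x) (osk x)).
    by rewrite mulmxDl -scalemxAl scalerDr addrACA.
  + move=> x v Y Z nY nZ; rewrite /nabla' (connection_add hnabla)//.
    by rewrite mulmxDr addrACA.
  + move=> x v f Y nf nY; rewrite /nabla' (connection_leibniz hnabla)//.
    by rewrite -scalemxAr scalerDr addrA.
  + move=> U X Y oU sX sY; apply: smooth_field_local => x Ux.
    have [U0 [J0 [oU0 U0x sJ hb]]] := local x; exists U0; split=> //.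
    have oV : open (U `&` U0) by exact: openI.
    have sXV := smooth_field_sub (@subIsetl _ U U0) sX.
    have sYV := smooth_field_sub (@subIsetl _ U U0) sY.
    have VU0 : U `&` U0 `<=` U0 by exact: subIsetr.
    have s := smooth_fieldD oV
      (adapted_smooth hQomega hnabla oU0 sJ hb oV VU0 sXV sYV)
      (stabilizer_part_smooth hQomega sJ oV VU0
        (difference_smooth hQomega hnabla oU0 sJ hb oV VU0 sXV) oV (@subset_refl _ _) sYV).
    apply: (smooth_field_congr oV _ s) => p [Up U0p].
    by rewrite (corrected U0 J0)//; exists U.
- move=> U A oU sA QA x v Ux; have [U0 [J0 [oU0 U0x sJ hb]]] := local x.
  have [J0t _] := hb x U0x.
  have J0o := aqsh_invariant hQomega (hb x U0x).
  set B := stabilizer_part (omega x) (J0^~ x) (difference S omega nabla J0 x v).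
  have BJ b : span3 (J0^~ x) (B *m J0 b x - J0 b x *m B).
    rewrite (stabilizer_part_comm (ob x) (ond x) (osk x) J0t J0o) scaler_sumr.
    under eq_bigr do rewrite scalerA.
    by apply: span3_lin => a; exact: span3_comm.
  have [q Qq qE] := endo_bundle_adapted hQomega hnabla oU0 sJ hb v n0 oU sA QA Ux U0x BJ.
  exists q => // Y nY; rewrite -qE// !(corrected U0 J0)//.
  exact: (smooth_field_near_endo oU Ux sA nY).
- move=> x v Y Z nY nZ; have [U0 [J0 [oU0 U0x sJ hb]]] := local x.
  have [J0t _] := hb x U0x.
  have J0o := aqsh_invariant hQomega (hb x U0x).
  rewrite !(corrected U0 J0)//.
  apply: (form2_adapted_add hQomega hnabla oU0 sJ hb v U0x nY nZ).
  exact: (adjoint_stabilizer_part (ob x) (ond x) (osk x) J0t J0o).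
Qed.
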